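(* There are a constant $\rho_0>0$ depending only on $n$ and constants $\varsigma>0$, $C>0$ depending only on $n,\lambda,\Lambda$ such that the following holds for every $\sigma=(\sigma_1,\dots,\sigma_n)\in(0,2)^n$. Let $f$ be a bounded continuous function on $\mathbb{R}^n$, let $u:\mathbb{R}^n\to\mathbb{R}$ satisfy $u\le 0$ in $\mathbb{R}^n\setminus B_1$ and $M^+u\ge -f$ in $B_1$ in the viscosity sense, and let $\Gamma$ be the concave envelope of $u$. Then there is a finite family of open rectangles $\{\mathcal R_j\}_{j\in\{1,\dots,m\}}$ (boxes of the form $R_{r,s}(x)$), with diameters $d_j$, such that: (1) any two different rectangles $\mathcal R_i$ and $\mathcal R_j$ in the family do not intersect; (2) $\{u=\Gamma\}\subset\bigcup_{j=1}^m\overline{\mathcal R}_j$; (3) $\{u=\Gamma\}\cap\overline{\mathcal R}_j\neq\emptyset$ for every $\mathcal R_j$; (4) $d_j\le\sqrt{\sum_{i=1}^n\left(\rho_0 2^{-1/q_{\max}}\right)^{\frac{2}{n+\sigma_i}}}$; (5) $\left|\nabla\Gamma(\overline{\mathcal R}_j)\right|\le C\left(\max_{\overline{\mathcal R}_j}f^+\right)^n\left|\overline{\mathcal R}_j\right|$; (6) $\left|\left\{y\in C\tilde{\mathcal R}_j: u(y)\ge\Gamma(y)-C\left(\max_{\overline{\mathcal R}_j}f\right)(\tilde d_j)^2\right\}\right|\ge\varsigma\left|\tilde{\mathcal R}_j\right|$, where $\tilde{\mathcal R}_j$ is the box corresponding to $\mathcal R_j$ and $\tilde d_j$ is its diamet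er.
   Context: Setting: $0<\lambda\le\Lambda$, $\sigma=(\sigma_1,\dots,\sigma_n)$ with $0<\sigma_i<2$, $\sigma_{\min}=\min_i\sigma_i$, $\sigma_{\max}=\max_i\sigma_i$, and $$c_\sigma=-1+\frac{3}{n+\sigma_{\max}}+\sum_{j\ne i_0}\frac{1}{n+\sigma_j},$$ where $i_0$ is an index with $\sigma_{i_0}=\sigma_{\max}$. Write $\delta(u,x,y)=u(x+y)+u(x-y)-2u(x)$, $\delta^\pm$ its positive and negative parts. The extremal operators are $$M^+u(x)=c_\sigma\int_{\mathbb{R}^n}\frac{\Lambda\delta^+(u,x,y)-\lambda\delta^-(u,x,y)}{\sum_{i=1}^n|y_i|^{n+\sigma_i}}\,dy,\qquad M^-u(x)=c_\sigma\int_{\mathbb{R}^n}\frac{\lambda\delta^+(u,x,y)-\Lambda\delta^-(u,x,y)}{\sum_{i=1}^n|y_i|^{n+\sigma_i}}\,dy.$$ Viscosity sense: for $f$ bounded and continuous and $J\in\{M^+,M^-\}$, a function $u:\mathbb{R}^n\to\mathbb{R}$, upper (lower) semicontinuous in $\overline\Omega$, satisfies $Ju\ge f$ ($Ju\le f$) in $\Omega$ if whenever $x_0\in\Omega$, $B_r(x_0)\subset\Omega$, $\phi\in C^2(\overline{B_r(x_0)})$, $\phi(x_0)=u(x_0)$ and $\phi>u$ ($\phi<u$) in $B_r(x_0)\setminus\{x_0\}$, the function $v$ equal to $\phi$ in $B_r(x_0)$ and to $u$ outside satisfies $Jv(x_0)\ge f(x_0)$ ($Jv(x_0)\le f(x_0)$).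 $B_r$ is the ball of radius $r$ centered at $0$. Concave envelope: for $u$ non-positive outside $B_1$, $\Gamma(x)=\min\{p(x): p \text{ affine},\ p\ge u^+\text{ in }B_3\}$ for $x\in B_3$, and $\Gamma=0$ in $\mathbb{R}^n\setminus B_3$. $\nabla\Gamma(x)$ denotes any element of the superdifferential of $\Gamma$ at $x$, and $\nabla\Gamma(A)$ the set of all such elements for $x\in A$. $q_i=-1+\frac{3}{n+\sigma_i}+\sum_{j\ne i}\frac{1}{n+\sigma_j}$ and $q_{\max}=\max\{q_1,\dots,q_n\}$. Boxes: $R_{r,s}(x)=\{y: |y_i-x_i|<s^{\frac{1}{n+\sigma_{\min}}}r^{\frac{1}{n+\sigma_i}}\ \forall i\}$; the box corresponding to $R_{r,s}(x)$ is $\tilde R_{r,s}(x)=\{y: |y_i-x_i|<(sr)^{\frac{1}{n+\sigma_i}}\ \forall i\}$. For a box $\tilde{\mathcal R}$, $C\tilde{\mathcal R}$ is its dilation by the factor $C$ about its center. $|\cdot|$ of a set is Lebesgue measure.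
   Formalization: The set {u=Γ} is taken inside B_1 only: since Γ=0 outside B_3, the literal set can be unbounded (e.g. u a bump supported in B_1), so no finite family of boxes covers it; u is also assumed Lebesgue measurable so that M^+ makes sense. *)

(* Defs.v *)
From HB Require Import structures.
From mathcomp Require Import all_boot all_order all_algebra.
From mathcomp Require Import all_classical all_reals all_analysis.

Set Implicit Arguments.
Unset Strict Implicit.
Unset Printing Implicit Defensive.
Import Order.TTheory GRing.Theory Num.Theory.
Import numFieldNormedType.Exports.

Local Open Scope classical_set_scope.
Local Open Scope ring_scope.

(* Points of R^n are row vectors.  Their library norm is the sup norm, which
   gives the usual topology; the Euclidean norm is [enorm] below. *)

Definition measure_rV_display : nat -> measure_display.
Proof. by move=> _; exact: default_measure_display. Qed.

Section borel_rV.
Context (R : realType) (n : nat).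

Definition rV_coord (i : 'I_n) (x : 'rV[R]_n) : measurableTypeR R := x ord0 i.

Let rV_set0 : g_sigma_preimage rV_coord set0.
Proof. exact: sigma_algebra0. Qed.

Let rV_setC A : g_sigma_preimage rV_coord A -> g_sigma_preimage rV_coord (~` A).
Proof. exact: sigma_algebraC. Qed.

Let rV_bigcup (F : (set 'rV[R]_n)^nat) :
  (forall i, g_sigma_preimage rV_coord (F i)) ->
  g_sigma_preimage rV_coord (\bigcup_i F i).
Proof. exact: sigma_algebra_bigcup. Qed.

HB.instance Definition _ := @isMeasurable.Build (measure_rV_display n)
  'rV[R]_n (g_sigma_preimage rV_coord) rV_set0 rV_setC rV_bigcup.

Lemma measurable_rV_coord i : measurable_fun [set: 'rV[R]_n] (rV_coord i).
Proof.
move=> _ Y mY; rewrite setTI; apply: sub_sigma_algebra => /=.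
rewrite -bigcup_seq/=; exists i => /=; first by rewrite mem_index_enum.
by exists Y => //; rewrite setTI.
Qed.

Lemma measurable_fun_rV d (T : measurableType d) (f : T -> 'rV[R]_n) :
  (forall i, measurable_fun [set: T] (rV_coord i \o f)) ->
  measurable_fun [set: T] f.
Proof.
move=> mf _ A mA; rewrite setTI.
suff : g_sigma_preimage rV_coord `<=` [set B | measurable (f @^-1` B)].
  by move=> /(_ A mA).
apply: smallest_sub.
  split => /= [|B mB|F mF].
  - by rewrite preimage_set0.
  - by rewrite setTD preimage_setC; exact: measurableC.
  - by rewrite preimage_bigcup; exact: bigcup_measurable.
move=> B; rewrite -bigcup_seq => -[i _ [Y mY <-]] /=; rewrite setTI.
by rewrite -comp_preimage -[X in measurable X]setTI; exact: mf.
Qed.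

End borel_rV.

Section cons_rV.
Context (R : realType) (n : nat).

Definition cons_rV (p : measurableTypeR R * 'rV[R]_n) : 'rV[R]_n.+1 :=
  row_mx (p.1)%:M p.2.

Definition uncons_rV (x : 'rV[R]_n.+1) : measurableTypeR R * 'rV[R]_n :=
  ((x : 'rV[R]_(1 + n)) ord0 (lshift n ord0), rsubmx (x : 'rV[R]_(1 + n))).

Lemma cons_rVK : cancel cons_rV uncons_rV.
Proof.
case=> a v; rewrite /uncons_rV /cons_rV /=.
by rewrite (@row_mxEl _ 1 1 n) (@row_mxKr _ 1 1 n) mxE eqxx.
Qed.

Lemma measurable_cons_rV : measurable_fun [set: _] cons_rV.
Proof.
apply: measurable_fun_rV => i.
have [j ->|j ->] := split_ordP (i : 'I_(1 + n)).
  apply: (eq_measurable_fun fst) => [[a v] _|]; last exact: measurable_fst.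
  by rewrite /rV_coord /cons_rV /= (@row_mxEl _ 1 1 n) (ord1 j) mxE eqxx.
apply: (eq_measurable_fun (rV_coord j \o snd)) => [[a v] _|].
  by rewrite /rV_coord /cons_rV /= (@row_mxEr _ 1 1 n).
by apply: measurableT_comp; [exact: measurable_rV_coord|exact: measurable_snd].
Qed.

Lemma measurable_uncons_rV : measurable_fun [set: _] uncons_rV.
Proof.
apply: measurable_fun_pair; first exact: (@measurable_rV_coord R n.+1).
apply: measurable_fun_rV => i.
apply: (eq_measurable_fun (@rV_coord R n.+1 (rshift 1 i))) => [x _|].
  by rewrite /rV_coord /= mxE.
exact: (@measurable_rV_coord R n.+1).
Qed.

Variable mu : {sigma_finite_measure set 'rV[R]_n -> \bar R}.

Definition cons_measure : set 'rV[R]_n.+1 -> \bar R :=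
  pushforward (@lebesgue_measure R \x mu)%E cons_rV.

Let cons_measure0 : cons_measure set0 = 0%E.
Proof. by rewrite /cons_measure /pushforward preimage_set0 measure0. Qed.

Let cons_measure_ge0 A : (0 <= cons_measure A)%E.
Proof. by rewrite /cons_measure /pushforward measure_ge0. Qed.

Let cons_measure_sigma_additive : semi_sigma_additive cons_measure.
Proof.
move=> F mF tF mUF; rewrite /cons_measure /pushforward preimage_bigcup.
apply: measure_semi_sigma_additive.
- by move=> k; rewrite -[X in measurable X]setTI; exact: measurable_cons_rV.
- apply/trivIsetP => i j _ _ ij; rewrite -preimage_setI.
  by move/trivIsetP : tF => ->//; rewrite preimage_set0.
- by rewrite -preimage_bigcup -[X in measurable X]setTI;
    exact: measurable_cons_rV.
Qed.

HB.instance Definition _ := isMeasure.Build _ _ _ cons_measure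
  cons_measure0 cons_measure_ge0 cons_measure_sigma_additive.

Let cons_measure_sigma_finite : sigma_finite setT cons_measure.
Proof.
have /sigma_finiteP[F [FT ndF mF]] := sigma_finiteT (@lebesgue_measure R).
have /sigma_finiteP[G [GT ndG mG]] := sigma_finiteT mu.
exists (fun k => uncons_rV @^-1` (F k `*` G k)).
  rewrite -preimage_bigcup (_ : \bigcup_k _ = setT) ?preimage_setT//.
  rewrite -subTset => -[a v] _.
  have [i _ Fi] : (\bigcup_k F k) a by rewrite -FT.
  have [j _ Gj] : (\bigcup_k G k) v by rewrite -GT.
  exists (maxn i j) => //; split => /=.
    by move: a Fi; exact/subsetPset/ndF/leq_maxl.
  by move: v Gj; exact/subsetPset/ndG/leq_maxr.
move=> k; have [mFk Fk] := mF k; have [mGk Gk] := mG k; split.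
  by rewrite -[X in measurable X]setTI; apply: measurable_uncons_rV => //;
    exact: measurableX.
rewrite /cons_measure /pushforward -comp_preimage.
have -> : uncons_rV \o cons_rV = id by apply/funext; exact: cons_rVK.
by rewrite preimage_id product_measure1E// lte_mul_pinfty// ge0_fin_numE.
Qed.

HB.instance Definition _ :=
  Measure_isSigmaFinite.Build _ _ _ cons_measure cons_measure_sigma_finite.

End cons_rV.

(* n-fold product of the Lebesgue measure of R, on the Borel sets of R^n *)
Fixpoint borel_lebesgue (R : realType) (n : nat) :
    {sigma_finite_measure set 'rV[R]_n -> \bar R} :=
  if n is n'.+1 then cons_measure (borel_lebesgue R n')
  else dirac (0 : 'rV[R]_0).

(* R^n with the sigma-algebra of Lebesgue measurable sets, i.e., the sets that
   are Caratheodory measurable for the Lebesgue outer measure *)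
Notation lebesgue_rV_type R n := (caratheodory_type (borel_lebesgue R n)^*%mu).

Definition lebesgue_rV (R : realType) (n : nat) :
    set (lebesgue_rV_type R n) -> \bar R :=
  @completed_measure_extension _ _ _ (borel_lebesgue R n).

HB.instance Definition _ (R : realType) (n : nat) :=
  Measure.on (@lebesgue_rV R n).

Section euclidean.
Context (R : realType) (n : nat).
Implicit Types (x y : 'rV[R]_n) (A : set 'rV[R]_n).

Definition dot x y : R := \sum_i x ord0 i * y ord0 i.

Definition enorm x : R := Num.sqrt (\sum_i x ord0 i ^+ 2).

Definition eball x (r : R) : set 'rV[R]_n := [set y | enorm (y - x) < r].

Definition diam A : R := sup [set enorm (p.1 - p.2) | p in A `*` A].

Definition dilate (c : R) x A : set 'rV[R]_n :=
  [set x + c *: (y - x) | y in A].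

End euclidean.

Section operators.
Context (R : realType) (n : nat).
Local Notation N := n.+1.
Implicit Types (u phi g : 'rV[R]_N -> R) (sigma : 'I_N -> R).
Implicit Types (A U Omega : set 'rV[R]_N).

Definition sigma_min sigma : R := \big[Num.min/sigma ord0]_i sigma i.

Definition q_ sigma i : R :=
  -1 + 3 / (N%:R + sigma i) + \sum_(j | j != i) 1 / (N%:R + sigma j).

Definition q_max sigma : R := \big[Num.max/q_ sigma ord0]_i q_ sigma i.

Definition c_ sigma : R := q_ sigma [arg max_(i > ord0) sigma i]%O.

Definition second_diff u (x y : 'rV[R]_N) : R := u (x + y) + u (x - y) - 2 * u x.

(* The integral is extended real valued: it is -oo when only the negative part
   of the integrand fails to be integrable. *)
Definition Mplus sigma (lambda Lambda : R) u (x : 'rV[R]_N) : \bar R :=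
  ((c_ sigma)%:E * \int[@lebesgue_rV R N]_y
    ((Lambda * Num.max (second_diff u x y) 0
      - lambda * Num.max (- second_diff u x y) 0)
     / \sum_i `|y ord0 i| `^ (N%:R + sigma i))%:E)%E.

Fixpoint Ck (k : nat) U phi : Prop :=
  (forall x, U x -> {for x, continuous phi}) /\
  if k is k'.+1 then
    forall i : 'I_N,
      (forall x, U x -> derivable phi x (delta_mx ord0 i)) /\
      Ck k' U (fun x => derive phi x (delta_mx ord0 i))
  else True.

(* C^2 up to the boundary: C^2 in some neighbourhood of A *)
Definition C2_on A phi : Prop :=
  exists U, [/\ open U, A `<=` U & Ck 2 U phi].

Definition upper_semicontinuous_on A u : Prop :=
  forall x a, A x -> u x < a -> \forall y \near within A (nbhs x), u y < a.

(* J u >= g in Omega in the viscosity sense *)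
Definition viscosity_subsolution (J : ('rV[R]_N -> R) -> 'rV[R]_N -> \bar R)
    Omega g u : Prop :=
  upper_semicontinuous_on (closure Omega) u /\
  forall x0 (r : R) phi,
    Omega x0 -> 0 < r -> eball x0 r `<=` Omega ->
    C2_on (closure (eball x0 r)) phi ->
    phi x0 = u x0 ->
    (forall x, eball x0 r x -> x <> x0 -> u x < phi x) ->
    ((g x0)%:E <= J (patch u (eball x0 r) phi) x0)%E.

Definition concave_envelope u (x : 'rV[R]_N) : R :=
  if x \in eball 0 3 then
    inf [set p | exists (a : R) (b : 'rV[R]_N),
      (forall y, eball 0 3 y -> Num.max (u y) 0 <= a + dot b y) /\
      p = a + dot b x]
  else 0.

(* The envelope is concave in the ball of radius 3 only (it vanishes outside),
   so superdifferentials are relative to that ball. *)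
Definition superdifferential (Gamma : 'rV[R]_N -> R) x : set 'rV[R]_N :=
  [set b | eball 0 3 x /\
    forall y, eball 0 3 y -> Gamma y <= Gamma x + dot b (y - x)].

Definition grad_image Gamma A : set 'rV[R]_N :=
  \bigcup_(x in A) superdifferential Gamma x.

(* The contact set is taken in B_1, where the equation is posed.  If u is
   positive somewhere, these are all the contact points in B_3; outside B_3 the
   equality u = Gamma would just mean u = 0. *)
Definition contact_set u (Gamma : 'rV[R]_N -> R) : set 'rV[R]_N :=
  [set x | eball 0 1 x /\ u x = Gamma x].

Definition Rbox sigma (r s : R) (x : 'rV[R]_N) : set 'rV[R]_N :=
  [set y | forall i, `|y ord0 i - x ord0 i| <
    s `^ (1 / (N%:R + sigma_min sigma)) * r `^ (1 / (N%:R + sigma i))].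

Definition Rbox_tilde sigma (r s : R) (x : 'rV[R]_N) : set 'rV[R]_N :=
  [set y | forall i, `|y ord0 i - x ord0 i| <
    (s * r) `^ (1 / (N%:R + sigma i))].

End operators.

(* Main.v *)
(* The family consists of cubes, i.e., of boxes R_{r,s} with r = 1.  Let N be the
   dimension, p = N + sigma_min, and for a <= 1 let S_a be the box with
   half-sides a^(p/(N+sigma_i)) >= a, which is \tilde R_{1,a^p}.

   At a contact point x the second difference of u is nonpositive, so testing the
   equation with a supporting plane of Gamma plus a small multiple of a function
   that is flat at x bounds the integral of its negative part against the kernel
   by f(x) / (c_sigma lambda).  The kernel dominates, up to a constant, the sum
   over j of a_j^(-p) 1_{S_(a_j)} for a_j = a_0 2^(-j), and c_sigma times the sum of
   a_j^2 |S_(a_j)| / a_j^p is bounded below uniformly in sigma, because all q_i are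
   comparable.  By pigeonhole there is a scale a, in a finite range depending on
   sigma only, at which u >= plane - A f(x) a^2 on all but a small fraction of
   x + S_a.  Concavity turns this into the same bound for Gamma on the half-size
   box, so that the superdifferentials over the cube of size a/8 lie in a cube of
   size comparable to f(x) a.  Measuring the deviation by a^2, the square of the
   shortest side, and not by the square of the diameter, is what makes the
   gradient estimate uniform.  The family is made of the maximal dyadic cubes
   whose closure contains a contact point with a good scale equal to the size of
   the cube. *)

From HB Require Import structures.
Require Import Defs.
From mathcomp Require Import all_boot all_order all_algebra.
From mathcomp Require Import all_classical all_reals all_analysis.
From mathcomp Require Import measurable_realfun ring lra.

Import Order.TTheory GRing.Theory Num.Theory.
Import numFieldNormedType.Exports.

Local Open Scope classical_set_scope.
Local Open Scope ring_scope.

Set Implicit Arguments.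
Unset Strict Implicit.
Unset Printing Implicit Defensive.

(** * Lebesgue measure on R^n *)

Section lebesgue_rV_theory.
Context {R : realType}.
Implicit Types n : nat.

Definition obox n (c w : 'rV[R]_n) : set 'rV[R]_n :=
  [set y | forall i, `|y ord0 i - c ord0 i| < w ord0 i].

Definition cbox n (c w : 'rV[R]_n) : set 'rV[R]_n :=
  [set y | forall i, `|y ord0 i - c ord0 i| <= w ord0 i].

(** Reflection in the point [c / 2]. Two of them compose to a translation, as in
    [x0 + y = pointrefl x0 (pointrefl 0 y)], so invariance under these maps covers both arguments of
    a second difference. *)
Definition pointrefl n (c : 'rV[R]_n) (y : 'rV[R]_n) : 'rV[R]_n := c - y.

Lemma pointreflK n (c : 'rV[R]_n) : involutive (pointrefl c).
Proof. by move=> y; rewrite /pointrefl opprB addrC subrK. Qed.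

Lemma lebesgue_measure_refl (c : R) (A : set (measurableTypeR R)) :
  measurable A -> lebesgue_measure ((fun x : R => c - x) @^-1` A) = lebesgue_measure A.
Proof.
move=> mA.
have mf : measurable_fun setT (fun x : measurableTypeR R => c - x : measurableTypeR R).
  exact: measurable_funB.
rewrite -[LHS]/(pushforward lebesgue_measure
  (fun x : measurableTypeR R => c - x : measurableTypeR R) A).
apply/esym/lebesgue_measure_unique => //.
move=> _ [[a b]] _ <-.
transitivity (@lebesgue_measure R `[c - b, c - a[%classic); last first.
  by congr lebesgue_measure; apply/seteqP; split => x /=; rewrite !in_itv/=; lra.
rewrite !lebesgue_measure_itv/= !lte_fin ltrD2l ltrN2 -!EFinD; case: ifP => // _.
by congr (_%:E); lra.
Qed.

Lemma measurable_pointrefl n (c : 'rV[R]_n) : measurable_fun setT (pointrefl c).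
Proof.
apply: measurable_fun_rV => i.
apply: (eq_measurable_fun (fun y => (c ord0 i - (rV_coord i y : R) : measurableTypeR R))).
  by move=> x _; rewrite /rV_coord /= /pointrefl !mxE.
by apply: measurable_funB => //; exact: measurable_rV_coord.
Qed.

(** Induction on the dimension: through [cons_rV] the reflection acts on each factor separately, so
    its pushforward has the right value on measurable rectangles, and the product measure is
    determined by these. *)
Lemma borel_lebesgue_refl n (c : 'rV[R]_n) (A : set 'rV[R]_n) :
  measurable A -> borel_lebesgue R n (pointrefl c @^-1` A) = borel_lebesgue R n A.
Proof.
elim: n c A => [|n IH] c A mA.
  congr (borel_lebesgue R 0 _); apply/seteqP; split => y /=;
  by rewrite (_ : pointrefl c y = y)//; apply/rowP => -[].
rewrite /= /cons_measure /pushforward.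
pose T (p : measurableTypeR R * 'rV[R]_n) : measurableTypeR R * 'rV[R]_n :=
  ((uncons_rV c).1 - p.1 : R, pointrefl (uncons_rV c).2 p.2).
have mT : measurable_fun setT T.
  apply: measurable_fun_pair.
    apply: measurable_funB => //; exact: measurable_fst.
  by apply: measurableT_comp; [exact: measurable_pointrefl|exact: measurable_snd].
rewrite (_ : @cons_rV R n @^-1` _ = T @^-1` (@cons_rV R n @^-1` A)); last first.
  rewrite -[LHS]comp_preimage -[RHS]comp_preimage; congr (_ @^-1` A).
  apply/funext => -[a v].
  rewrite /T /= /pointrefl /cons_rV /=.
  apply/rowP => i; rewrite !mxE.
  case: splitP => j ij; rewrite ?mxE ?ord1 ?eqxx /=.
    rewrite !mulr1n; congr (c _ _ - _); apply/val_inj => /=.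
    by rewrite ij (ord1 j).
  by congr (_ - _); congr (c _ _); exact/val_inj.
have mB : measurable (@cons_rV R n @^-1` A).
  by rewrite -[X in measurable X]setTI; exact: measurable_cons_rV.
rewrite -[LHS]/(pushforward (@lebesgue_measure R \x borel_lebesgue R n)%E T
  (@cons_rV R n @^-1` A)).
apply/esym/product_measure_unique => //.
move=> A1 A2 mA1 mA2.
transitivity ((@lebesgue_measure R \x borel_lebesgue R n)%E
  (((fun x : R => (uncons_rV c).1 - x) @^-1` A1)
   `*` (pointrefl (uncons_rV c).2 @^-1` A2))); first by [].
rewrite product_measure1E//.
- by congr (_ * _)%E; [exact: lebesgue_measure_refl|exact: IH].
- rewrite -[X in measurable X]setTI.
  have mf : measurable_fun setT
      (fun x : measurableTypeR R => (uncons_rV c).1 - x : measurableTypeR R).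
    exact: measurable_funB.
  exact: mf.
- by rewrite -[X in measurable X]setTI; exact: measurable_pointrefl.
Qed.

(** The value on an arbitrary set is an infimum over countable Borel covers, and reflected covers
    cover the reflected set. One inequality suffices because the reflection is an involution. *)
Lemma lebesgue_rV_refl n (c : 'rV[R]_n) (A : set 'rV[R]_n) :
  lebesgue_rV (pointrefl c @^-1` A) = lebesgue_rV A.
Proof.
have le B : (lebesgue_rV (pointrefl c @^-1` B) <= lebesgue_rV B)%E.
  rewrite /lebesgue_rV /completed_measure_extension /mu_ext.
  apply: le_ereal_inf_tmp => _ [F [mF BF] <-]; apply: ereal_inf_lbound.
  exists (fun k => pointrefl c @^-1` F k).
    split => [k|]; last by rewrite -preimage_bigcup; apply: preimage_subset.
    by rewrite -[X in measurable X]setTI; apply: measurable_pointrefl.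
  by apply: eq_eseriesr => k _; exact: borel_lebesgue_refl.
apply/eqP; rewrite eq_le le /=.
rewrite [leLHS](_ : _ = lebesgue_rV (pointrefl c @^-1` (pointrefl c @^-1` A))); first exact: le.
rewrite -comp_preimage (_ : _ \o _ = id)//.
by apply/funext => y /=; rewrite pointreflK.
Qed.

Lemma le_lebesgue_rV n (A B : set 'rV[R]_n) : A `<=` B ->
  (lebesgue_rV A <= lebesgue_rV B)%E.
Proof. exact: le_mu_ext. Qed.

Lemma lebesgue_rVU n (A B : set 'rV[R]_n) :
  (lebesgue_rV (A `|` B) <= lebesgue_rV A + lebesgue_rV B)%E.
Proof. exact: (outer_measureU2 (mu_ext (borel_lebesgue R n))). Qed.

Lemma measurable_lebesgue_rV n (A : set 'rV[R]_n) :
  measurable A -> measurable (A : set (lebesgue_rV_type R n)).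
Proof. by move=> mA; apply: sub_caratheodory; exact: sub_sigma_algebra. Qed.

Lemma lebesgue_rVE n (A : set 'rV[R]_n) : measurable A ->
  lebesgue_rV A = borel_lebesgue R n A.
Proof.
by move=> mA; rewrite /lebesgue_rV /completed_measure_extension measurable_mu_extE.
Qed.

(** The Caratheodory criterion for the reflected set with test set [X] is the criterion for [A] with
    the reflected test set. *)
Lemma measurable_pointrefl_completed n (c : 'rV[R]_n) :
  measurable_fun [set: lebesgue_rV_type R n]
    (pointrefl c : lebesgue_rV_type R n -> lebesgue_rV_type R n).
Proof.
move=> _ A; rewrite setTI.
rewrite -[measurable A]/(caratheodory_measurable (mu_ext (borel_lebesgue R n)) A).
rewrite -[measurable _]/(caratheodory_measurable (mu_ext (borel_lebesgue R n))
  (pointrefl c @^-1` A)).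
move=> mA X.
have E (B : set 'rV[R]_n) : pointrefl c @^-1` (pointrefl c @^-1` B) = B.
  by rewrite -comp_preimage (_ : _ \o _ = id)//; apply/funext => y /=; rewrite pointreflK.
have H := mA (pointrefl c @^-1` X).
have K (B : set 'rV[R]_n) := lebesgue_rV_refl c B.
rewrite /lebesgue_rV /completed_measure_extension in K.
rewrite -[in LHS](E X) K H; congr (_ + _)%E.
  by rewrite -[in LHS]K preimage_setI E.
by rewrite -[in LHS]K preimage_setI E preimage_setC.
Qed.

(** The boolean selects closed ([true]) or open ([false]) endpoints, so that a single induction
    computes the volume of both kinds of box. *)
Let itvb (b : bool) (c w : R) : set (measurableTypeR R) :=
  [set` Interval (BSide b (c - w)) (BSide (~~ b) (c + w))].

Let gbox (b : bool) n (c w : 'rV[R]_n) : set 'rV[R]_n :=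
  [set y | forall i, itvb b (c ord0 i) (w ord0 i) (y ord0 i)].

Let oboxE n (c w : 'rV[R]_n) : obox c w = gbox false c w.
Proof.
apply/seteqP; split => y /= yi i; have := yi i;
  by rewrite /itvb /= in_itv/= ltr_distl.
Qed.

Let cboxE n (c w : 'rV[R]_n) : cbox c w = gbox true c w.
Proof.
apply/seteqP; split => y /= yi i; have := yi i;
  by rewrite /itvb /= in_itv/= ler_distl.
Qed.

Let measurable_gbox b n (c w : 'rV[R]_n) : measurable (gbox b c w).
Proof.
rewrite [X in measurable X](_ : _ = \big[setI/setT]_(i < n)
   (rV_coord i @^-1` itvb b (c ord0 i) (w ord0 i))).
  apply: bigsetI_measurable => i _; rewrite -[X in measurable X]setTI.
  by apply: (measurable_rV_coord i) => //; exact: measurable_itv.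
rewrite -bigcap_seq; apply/seteqP; split => y /= H i; first by move=> _; exact: H.
by apply: H; rewrite /= mem_index_enum.
Qed.

Let gbox_measure b n (c w : 'rV[R]_n) : (forall i, 0 <= w ord0 i) ->
  borel_lebesgue R n (gbox b c w) = (\prod_i (2 * w ord0 i))%:E.
Proof.
elim: n c w => [|n IH] c w w0.
  by rewrite big_ord0 /= diracE mem_set// => -[].
rewrite big_ord_recl.
transitivity ((@lebesgue_measure R \x borel_lebesgue R n)%E
  (itvb b (c ord0 ord0) (w ord0 ord0) `*`
   gbox b (uncons_rV c).2 (uncons_rV w).2)).
  rewrite /= /cons_measure /pushforward; congr (product_measure1 _ _ _).
  have e0 : @lshift 1 n ord0 = ord0 :> 'I_n.+1 by exact/val_inj.
  apply/seteqP; split => -[a v] /=.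
    move=> H; split.
      by have := H (@lshift 1 n ord0); rewrite (@row_mxEl _ 1 1 n) mxE eqxx mulr1n e0.
    move=> i; have := H (rshift 1 i).
    by rewrite /cons_rV (@row_mxEr _ 1 1 n) !mxE.
  move=> [Ha Hv] i; have [j ->|j ->] := split_ordP (i : 'I_(1 + n)).
    rewrite /cons_rV /= (@row_mxEl _ 1 1 n) (ord1 j) mxE eqxx mulr1n.
    by rewrite e0.
  by have := Hv j; rewrite /cons_rV (@row_mxEr _ 1 1 n) !mxE.
rewrite product_measure1E//; last by first [exact: measurable_itv|exact: measurable_gbox].
transitivity ((2 * w ord0 ord0)%:E * (\prod_i (2 * w ord0 (lift ord0 i)))%:E)%E; last by [].
congr (_ * _)%E; last first.
  rewrite IH => [|i]; last by rewrite mxE.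
  congr (_%:E); apply: eq_bigr => i _; rewrite mxE; congr (_ * w _ _).
  exact/val_inj.
transitivity (@lebesgue_measure R (itvb b (c ord0 ord0) (w ord0 ord0))) => //.
rewrite /itvb lebesgue_measure_itv/= lte_fin.
case: ifPn => [_|]; first by rewrite -EFinD; congr (_%:E); lra.
rewrite -leNgt => h; congr (_%:E); have := w0 ord0; lra.
Qed.

Lemma measurable_obox n (c w : 'rV[R]_n) : measurable (obox c w).
Proof. by rewrite oboxE; exact: measurable_gbox. Qed.

Lemma measurable_cbox n (c w : 'rV[R]_n) : measurable (cbox c w).
Proof. by rewrite cboxE; exact: measurable_gbox. Qed.

Lemma lebesgue_rV_obox n (c w : 'rV[R]_n) : (forall i, 0 <= w ord0 i) ->
  lebesgue_rV (obox c w) = (\prod_i (2 * w ord0 i))%:E.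
Proof.
by move=> w0; rewrite lebesgue_rVE; [rewrite oboxE gbox_measure|exact: measurable_obox].
Qed.

Lemma lebesgue_rV_cbox n (c w : 'rV[R]_n) : (forall i, 0 <= w ord0 i) ->
  lebesgue_rV (cbox c w) = (\prod_i (2 * w ord0 i))%:E.
Proof.
by move=> w0; rewrite lebesgue_rVE; [rewrite cboxE gbox_measure|exact: measurable_cbox].
Qed.

Lemma prod_cube n (r : R) :
  \prod_i (2 * (const_mx r : 'rV[R]_n) ord0 i) = (2 * r) ^+ n.
Proof.
by rewrite (eq_bigr (fun=> 2 * r)) => [|i _]; rewrite ?mxE// prodr_const card_ord.
Qed.

End lebesgue_rV_theory.

(** * Concave envelopes *)

Section enorm_theory.
Context {R : realType} {n : nat}.
Implicit Types (x y z : 'rV[R]_n).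

Lemma dotC x y : dot x y = dot y x.
Proof. by apply: eq_bigr => i _; rewrite mulrC. Qed.

Lemma dotDr x y z : dot x (y + z) = dot x y + dot x z.
Proof. by rewrite -big_split; apply: eq_bigr => i _; rewrite !mxE mulrDr. Qed.

Lemma dotNr x y : dot x (- y) = - dot x y.
Proof. by rewrite -sumrN; apply: eq_bigr => i _; rewrite !mxE mulrN. Qed.

Lemma dotBr x y z : dot x (y - z) = dot x y - dot x z.
Proof. by rewrite dotDr dotNr. Qed.

Lemma dotDl x y z : dot (x + y) z = dot x z + dot y z.
Proof. by rewrite dotC dotDr !(dotC z). Qed.

Lemma dotNl x y : dot (- x) y = - dot x y.
Proof. by rewrite dotC dotNr dotC. Qed.

Lemma dotZr c x y : dot x (c *: y) = c * dot x y.
Proof. by rewrite mulr_sumr; apply: eq_bigr => i _; rewrite !mxE mulrCA. Qed.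

Lemma dotr0 x : dot x 0 = 0.
Proof. by rewrite /dot big1// => i _; rewrite mxE mulr0. Qed.

Lemma dot_delta x i : dot x (delta_mx ord0 i) = x ord0 i.
Proof.
rewrite /dot (bigD1 i)//= mxE !eqxx mulr1 big1 ?addr0// => j ji.
by rewrite mxE (negbTE ji) andbF mulr0.
Qed.

Lemma enorm_ge0 x : 0 <= enorm x.
Proof. exact: sqrtr_ge0. Qed.

Lemma sqr_enorm x : enorm x ^+ 2 = dot x x.
Proof.
by rewrite sqr_sqrtr ?sumr_ge0// => i _; rewrite sqr_ge0.
Qed.

Lemma enormN x : enorm (- x) = enorm x.
Proof. by congr Num.sqrt; apply: eq_bigr => i _; rewrite mxE sqrrN. Qed.

Lemma enorm0 : enorm (0 : 'rV[R]_n) = 0.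
Proof.
by rewrite /enorm big1 ?sqrtr0// => i _; rewrite mxE expr0n.
Qed.

(** Cauchy-Schwarz, by expanding the squared length of [enorm x ^+ 2 *: y - dot x y *: x]. *)
Lemma dot_le_enorm x y : dot x y <= enorm x * enorm y.
Proof.
have [x0|x0] := eqVneq (enorm x) 0.
  have xi i : x ord0 i = 0.
    apply/eqP; rewrite -sqrf_eq0 eq_le sqr_ge0 andbT.
    have : dot x x = 0 by rewrite -sqr_enorm x0 expr0n.
    move=> <-; rewrite /dot (bigD1 i)//= expr2 lerDl sumr_ge0// => j _.
    by rewrite -expr2 sqr_ge0.
  by rewrite x0 mul0r /dot big1// => i _; rewrite xi mul0r.
have {x0} x0 : 0 < enorm x by rewrite lt_neqAle eq_sym x0 enorm_ge0.
have : 0 <= dot (enorm x ^+ 2 *: y - dot x y *: x) (enorm x ^+ 2 *: y - dot x y *: x).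
  by rewrite -sqr_enorm sqr_ge0.
rewrite dotBr !dotZr (dotC _ y) (dotC _ x) !dotBr !dotZr (dotC y x) -!sqr_enorm.
move=> h; rewrite leNgt; apply/negP => hlt.
have e0 := enorm_ge0 y.
have : enorm x ^+ 2 * ((enorm x * enorm y) ^+ 2 - dot x y ^+ 2) >= 0 by nra.
rewrite pmulr_rge0 ?exprn_gt0// subr_ge0 => h2.
have h3 : 0 <= enorm x * enorm y by rewrite mulr_ge0// ltW.
nra.
Qed.

Lemma ler_enormD x y : enorm (x + y) <= enorm x + enorm y.
Proof.
rewrite -ler_sqr ?nnegrE ?addr_ge0 ?enorm_ge0//.
rewrite sqr_enorm dotDr !dotDl -!sqr_enorm (dotC y x).
have := dot_le_enorm x y; nra.
Qed.

Lemma ler_coord_enorm x i : `|x ord0 i| <= enorm x.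
Proof.
rewrite -ler_sqr ?nnegrE ?enorm_ge0// real_normK ?num_real// sqr_enorm.
rewrite /dot (bigD1 i)//= expr2 lerDl sumr_ge0// => j _.
by rewrite -expr2 sqr_ge0.
Qed.

Lemma eball0P x r : eball 0 r x <-> enorm x < r.
Proof. by rewrite /eball /= subr0. Qed.

End enorm_theory.

Section enorm_topology.
Context {R : realType} {n : nat}.

Lemma coord_le_norm (x : 'rV[R]_n) i : `|x ord0 i| <= `|x|.
Proof.
rewrite [leRHS]/Num.norm /= mx_normrE.
by apply: (@le_bigmax _ _ _ 0 (fun ij : 'I_1 * 'I_n => `|x ij.1 ij.2|) (ord0, i)).
Qed.

Lemma norm_le_coord (x : 'rV[R]_n) (M : R) : 0 <= M ->
  (forall i, `|x ord0 i| <= M) -> `|x| <= M.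
Proof.
move=> M0 xM; rewrite [leLHS]/Num.norm /= mx_normrE.
by apply/bigmax_leP; split => // -[i j] _ /=; rewrite (ord1 i).
Qed.

Lemma enorm_le_coord (x : 'rV[R]_n) (M : R) : 0 <= M ->
  (forall i, `|x ord0 i| <= M) -> enorm x <= n%:R * M.
Proof.
move=> M0 xM; case: n x xM => [|m] x xM.
  by rewrite (_ : x = 0) ?enorm0 ?mul0r//; apply/rowP => -[].
rewrite -ler_sqr ?nnegrE ?enorm_ge0 ?mulr_ge0//.
rewrite sqr_enorm /dot.
apply: (@le_trans _ _ (\sum_(i < m.+1) M ^+ 2)).
  apply: ler_sum => i _; rewrite -expr2 -real_normK ?num_real//.
  by rewrite ler_sqr ?nnegrE.
rewrite sumr_const card_ord -[leLHS]mulr_natl exprMn.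
rewrite ler_wpM2r ?sqr_ge0//.
by rewrite expr2 ler_peMr// ler1n.
Qed.

Lemma enorm_le_norm (x : 'rV[R]_n) : enorm x <= n%:R * `|x|.
Proof. by apply: enorm_le_coord => // i; exact: coord_le_norm. Qed.

Lemma closure_eball_le (r : R) (x : 'rV[R]_n) :
  closure (eball 0 r) x -> enorm x <= r.
Proof.
move=> clx; apply/ler_addgt0Pr => e e0.
have e1 : 0 < e / (n%:R + 1) by rewrite divr_gt0// ltr_wpDl.
have [y [/eball0P yr xy]] := clx _ (nbhsx_ballx x _ e1).
rewrite -[x](subrK y) (le_trans (ler_enormD _ _))// addrC lerD//; first exact: ltW.
rewrite (le_trans (enorm_le_norm _))//.
move: xy; rewrite -ball_normE /= => xy.
rewrite (le_trans (ler_wpM2l _ (ltW xy)))// mulrCA ger_pMr//.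
by rewrite ler_pdivrMr ?ltr_wpDl// mul1r lerDl.
Qed.

Lemma compact_closure_eball (r : R) : compact (closure (eball (0 : 'rV[R]_n) r)).
Proof.
apply: bounded_closed_compact; last exact: closed_closure.
exists `|r|; split => // M rM x /closure_eball_le xr /=.
apply: norm_le_coord => [|i]; first by rewrite (le_trans _ (ltW rM)).
by rewrite (le_trans (ler_coord_enorm _ _))// (le_trans xr)// (le_trans (ler_norm r))// ltW.
Qed.

End enorm_topology.

Section usc_bounded.
Context {R : realType} {n : nat}.
Local Notation N := n.+1.

(** Compactness in its near-covering form, with the filter of large [M] as parameter: around each
    [x] every [M] above [u x + 1] bounds [u] at the nearby points of [A]. *)
Lemma usc_compact_bounded (A : set 'rV[R]_N) (u : 'rV[R]_N -> R) :
  compact A -> upper_semicontinuous_on A u -> exists M, forall y, A y -> u y <= M.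
Proof.
move=> /compact_near_coveringP/near_covering_withinP cA uA.
suff [M []] : exists M, M \is Num.real /\ forall M', M < M' -> A `<=` (fun y => u y < M').
  move=> _ /(_ (M + 1)) H; exists (M + 1) => y Ay; apply/ltW/H => //.
  by rewrite ltrDl.
apply: (cA R (+oo) (fun M y => u y < M)) => x Ax.
have : u x < u x + 1 by rewrite ltrDl.
move=> /(uA _ _ Ax); rewrite near_withinE => nx.
exists ([set y | A y -> u y < u x + 1], [set M | u x + 1 < M]) => /=.
  by split => //; exists (u x + 1); split => //; exact: num_real.
by move=> [y M] /= [uy uM] Ay; exact: lt_trans (uy Ay) uM.
Qed.

End usc_bounded.

Section envelope.
Context {R : realType} {n : nat}.
Local Notation N := n.+1.
Variable u : 'rV[R]_N -> R.
Hypothesis u_neg : forall x, ~ eball 0 1 x -> u x <= 0.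
Hypothesis u_usc : upper_semicontinuous_on (closure (eball 0 1)) u.
Local Notation Gamma := (concave_envelope u).

Let majorant (a : R) (b : 'rV[R]_N) :=
  forall y, eball 0 3 y -> Num.max (u y) 0 <= a + dot b y.

Let majorant_exists : exists M : R, majorant M 0.
Proof.
have [M uM] := usc_compact_bounded (@compact_closure_eball _ _ _) u_usc.
exists (Num.max M 0) => y _.
rewrite dotC dotr0 addr0.
have [y1|/u_neg y1] := pselect (eball 0 1 y); last first.
  by rewrite (max_idPr y1) le_max lexx orbT.
by apply: le_max2 => //; apply: uM; exact: subset_closure.
Qed.

Let vals x := [set p | exists (a : R) (b : 'rV[R]_N), majorant a b /\ p = a + dot b x].

Let has_inf_vals x : eball 0 3 x -> has_inf (vals x).
Proof.
move=> x3; split.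
  by have [M mM] := majorant_exists; exists (M + dot 0 x); exists M, 0.
exists (Num.max (u x) 0) => _ [a [b [mab ->]]]; exact: mab.
Qed.

Let envE x : eball 0 3 x -> Gamma x = inf (vals x).
Proof. by move=> x3; rewrite /concave_envelope mem_set. Qed.

Lemma le_envelope x : eball 0 3 x -> Num.max (u x) 0 <= Gamma x.
Proof.
move=> x3; rewrite envE//; apply: lb_le_inf; first by have [] := has_inf_vals x3.
by move=> _ [a [b [mab ->]]]; exact: mab.
Qed.

Lemma envelope_le_affine (a : R) (b : 'rV[R]_N) x :
  (forall y, eball 0 3 y -> Num.max (u y) 0 <= a + dot b y) ->
  eball 0 3 x -> Gamma x <= a + dot b x.
Proof.
move=> mab x3; rewrite envE//; apply: ge_inf; first by have [] := has_inf_vals x3.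
by exists a, b.
Qed.

(** An infimum of affine functions is concave. The midpoint form is the one that pairs with second
    differences. *)
Lemma envelope_midpoint x y z : eball 0 3 x -> eball 0 3 y -> eball 0 3 z ->
  y + z = x + x -> Gamma y + Gamma z <= 2 * Gamma x.
Proof.
move=> x3 y3 z3 yzx; rewrite -ler_pdivrMl// (envE x3).
apply: lb_le_inf; first by have [] := has_inf_vals x3.
move=> _ [a [b [mab ->]]]; rewrite ler_pdivrMl//.
apply: (le_trans (lerD (envelope_le_affine mab y3) (envelope_le_affine mab z3))).
have : dot b y + dot b z = dot b x + dot b x by rewrite -!dotDr yzx.
lra.
Qed.

(** The slopes of affine majorants that are nearly minimal at [x] form a bounded sequence, and any
    cluster point of it is a supergradient. *)
Lemma superdifferential_neq0 x : eball 0 1 x ->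
  superdifferential Gamma x !=set0.
Proof.
move=> /eball0P x1.
have x3 : eball 0 3 x by apply/eball0P; lra.
have near_min k : exists ab : R * 'rV[R]_N, majorant ab.1 ab.2 /\
    ab.1 + dot ab.2 x < Gamma x + k.+1%:R^-1.
  have k0 : 0 < k.+1%:R^-1 :> R by rewrite invr_gt0.
  have [_ [a [b [mab ->]]]] := inf_adherent k0 (has_inf_vals x3).
  by rewrite -envE// => ?; exists (a, b).
have [ab abP] := choice near_min.
pose b k := (ab k).2.
have bmaj k y : eball 0 3 y ->
    Num.max (u y) 0 <= Gamma x + k.+1%:R^-1 + dot (b k) (y - x).
  move=> y3; have [mab ltab] := abP k; apply: (le_trans (mab _ y3)).
  by move: ltab; rewrite dotBr /b; move: (k.+1%:R^-1) => e; lra.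
have Gx0 : 0 <= Gamma x.
  by rewrite (le_trans _ (le_envelope x3))// le_max lexx orbT.
have bbnd k : `|b k| <= Gamma x + 1.
  apply: norm_le_coord => [|i]; first by rewrite addr_ge0.
  have k1 : k.+1%:R^-1 <= 1 :> R by rewrite invf_le1// ler1n.
  rewrite ler_norml.
  (* The points at distance 1 from [x] along an axis stay in the ball of radius 3, where the
     majorants are nonnegative; this bounds each slope coordinate from both sides. *)
  have H (s : R) : `|s| = 1 -> 0 <= Gamma x + 1 + s * b k ord0 i.
    move=> s1.
    have /(bmaj k) : eball 0 3 (x + s *: delta_mx ord0 i).
      apply/eball0P; apply: le_lt_trans (ler_enormD _ _) _.
      suff -> : enorm (s *: delta_mx ord0 i : 'rV[R]_N) = 1 by lra.
      apply/eqP; rewrite -sqrp_eq1 ?enorm_ge0// sqr_enorm dotZr dotC dotZr dot_delta.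
      by rewrite mxE !eqxx mulr1 -expr2 -real_normK ?num_real// s1 expr1n.
    rewrite [X in dot _ X]addrAC subrr add0r dotZr dot_delta => h.
    have : 0 <= Num.max (u (x + s *: delta_mx ord0 i)) 0 by rewrite le_max lexx orbT.
    by move: h k1; move: (k.+1%:R^-1) => t; lra.
  have := H 1 (normr1 _); have := H (-1); rewrite normrN1 => /(_ erefl).
  by move=> *; apply/andP; split; lra.
pose K := [set v : 'rV[R]_N | `|v| <= Gamma x + 1].
have cK : compact K.
  apply: bounded_closed_compact.
    exists (Gamma x + 1); split; first exact: num_real.
    by move=> M GM v /= vM; rewrite (le_trans vM)// ltW.
  rewrite (_ : K = Num.norm @^-1` [set t : R | t <= Gamma x + 1])//.
  apply: closed_comp => [v _|]; first exact: norm_continuous.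
  exact: closed_le.
have FK : (b @ \oo) K by exists 0%N => // k _; exact: bbnd.
have [b0 [_ b0P]] := cK _ _ FK.
exists b0; split => // y y3.
have plane z : Gamma x + dot b0 (z - x) = (Gamma x - dot b0 x) + dot b0 z.
  by rewrite dotBr; ring.
rewrite plane; apply: envelope_le_affine => // {y3}y y3.
rewrite -plane.
apply/ler_addgt0Pr => e e0.
(* The error [e] is split in two: indices from [m] on make the defect of minimality at most [e / 2],
   and the radius below makes the change of slope cost at most [e / 2] at [y]. *)
pose m := Num.truncn (2 / e).
have b1 : 0 < e / 2 / (N%:R * (enorm (y - x) + 1)).
  by rewrite !divr_gt0// mulr_gt0// ltr_wpDl// enorm_ge0.
have mem : (b @ \oo) [set b k | k in [set k | (m <= k)%N]].
  by exists m => // k /= mk; exists k.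
have [_ [[k mk <-]]] := b0P _ _ mem (nbhsx_ballx b0 _ b1).
rewrite -ball_normE /= => bk.
apply: le_trans (bmaj k y y3) _.
have mk2 : k.+1%:R^-1 <= e / 2.
  rewrite invf_ple ?posrE ?divr_gt0// invf_div.
  have /ltW h : 2 / e < m.+1%:R by exact: truncnS_gt.
  by rewrite (le_trans h)// ler_nat ltnS.
have hd : dot (b k - b0) (y - x) <= e / 2.
  apply: le_trans (dot_le_enorm _ _) _.
  have en0 := enorm_ge0 (y - x).
  apply: (@le_trans _ _ (enorm (b k - b0) * (enorm (y - x) + 1))).
    by rewrite ler_wpM2l ?enorm_ge0// lerDl.
  rewrite -ler_pdivlMr; last by rewrite ltr_wpDl.
  apply: le_trans (enorm_le_norm _) _; rewrite distrC.
  rewrite ler_pdivlMr; last by rewrite ltr_wpDl.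
  move: bk; rewrite ltr_pdivlMr; last by rewrite mulr_gt0// ltr_wpDl.
  by move=> /ltW; rewrite mulrA (mulrC N%:R).
move: hd mk2; rewrite dotDl dotNl; move: (k.+1%:R^-1) => t; lra.
Qed.

End envelope.

(** * Smoothness of separable polynomials *)

Section separable_polynomial.
Context {R : realType} {n : nat}.
Local Notation N := n.+1.
Implicit Types (P : 'I_N -> {poly R}) (c : R).

Let F c P (y : 'rV[R]_N) := c + \sum_i (P i).[y ord0 i].

Let F_quotient c P (x : 'rV[R]_N) i :
  (fun h : R => h^-1 *: ((F c P \o shift x) (h *: delta_mx ord0 i) - F c P x)) =
  (fun h : R => h^-1 *: ((horner (P i) \o shift (x ord0 i)) (h *: 1) -
                         (P i).[x ord0 i])).
Proof.
apply/funext => h; congr (_ *: _); rewrite /= /F.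
rewrite opprD addrACA subrr add0r -sumrB (bigD1 i)//= big1 ?addr0.
  by rewrite !mxE !eqxx.
by move=> j ji; rewrite !mxE (negbTE ji) andbF mulr0 add0r subrr.
Qed.

Let derivable_F c P x i : derivable (F c P) x (delta_mx ord0 i).
Proof.
rewrite /derivable F_quotient; have := @derivable_horner _ (P i) (x ord0 i).
by rewrite /derivable.
Qed.

Let derive_F c P x i : derive (F c P) x (delta_mx ord0 i) =
  F 0 (fun j => if j == i then (P i)^`() else 0) x.
Proof.
rewrite /derive F_quotient -[LHS]/(derive (horner (P i)) (x ord0 i) 1).
rewrite (derive_val (is_derive := is_derive_poly (P i) (x ord0 i))).
rewrite /F add0r (bigD1 i)//= eqxx big1 ?addr0// => j /negbTE ->.
by rewrite horner0.
Qed.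

Let continuous_F c P : continuous (F c P).
Proof.
move=> x; apply: continuousD; first exact: cst_continuous.
apply: continuous_big; first exact: add_continuous.
move=> i _ y; apply: (@continuous_comp _ _ _ (fun y : 'rV[R]_N => y ord0 i)).
  exact: coord_continuous.
exact: continuous_horner.
Qed.

(** This class of functions is closed under partial derivatives: the derivative along axis [i] keeps
    only the derivative of [P i]. Hence the induction on [k]. *)
Lemma Ck_separable_polynomial k c P :
  Ck k [set: 'rV[R]_N] (fun y => c + \sum_i (P i).[y ord0 i]).
Proof.
elim: k c P => [|k IH] c P /=; first by split => // x _; exact: continuous_F.
split => [x _|i]; first exact: continuous_F.
split => [x _|]; first exact: derivable_F.
rewrite (_ : (fun x => _) = F 0 (fun j => if j == i then (P i)^`() else 0)).
  exact: IH.
by apply/funext => x; exact: derive_F.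
Qed.

End separable_polynomial.

(** * Bounding an integral from above by indicator functions *)

Section integral_upper_bound.
Context d (T : measurableType d) (R : realType).
Variable mu : {measure set T -> \bar R}.
Local Open Scope ereal_scope.

(* Unlike [ge0_le_integral], no measurability is required. *)
Lemma ge0_le_integralT (g h : T -> \bar R) : (forall x, 0 <= g x) ->
  (forall x, g x <= h x) -> \int[mu]_x g x <= \int[mu]_x h x.
Proof.
move=> g0 gh; have h0 x : 0 <= h x by exact: le_trans (gh x).
rewrite !ge0_integralTE//; apply: ereal_sup_le => _ [k kg <-] /=.
by exists k => // x; exact: le_trans (kg x) (gh x).
Qed.

(** The positive part of [F] is at most [k] on [D] and zero elsewhere. The negative part dominates
    the sum: off [D] by the assumed bound, on [D] because the sum vanishes there. *)
Lemma integral_le_indic (F : T -> R) (k : R) (D : set T) J (al : 'I_J -> R)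
    (W : 'I_J -> set T) :
  (0 <= k)%R -> measurable D -> (forall j, (0 <= al j)%R) ->
  (forall j, measurable (W j)) -> (forall j, W j `&` D = set0) ->
  (forall x, (F x <= k * \1_D x - \sum_j al j * \1_(W j) x)%R) ->
  \int[mu]_x (F x)%:E <= k%:E * mu D - \sum_j (al j)%:E * mu (W j).
Proof.
move=> k0 mD al0 mW WD Fle.
have sum0 x : (0 <= \sum_j al j * \1_(W j) x)%R.
  by apply: sumr_ge0 => j _; rewrite mulr_ge0.
rewrite integralE; apply: leeB.
  apply: (@le_trans _ _ (\int[mu]_x (k * \1_D x)%:E)).
    apply: ge0_le_integralT => // x; rewrite funeposE -EFin_max lee_fin.
    rewrite ge_max mulr_ge0// andbT (le_trans (Fle x))// gerBl; exact: sum0.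
  rewrite (integralZl_indic (m := mu) measurableT (fun=> D)) ?integral_indic ?setIT//.
  by rewrite ltNge k0.
apply: (@le_trans _ _ (\int[mu]_x (\sum_j (al j * \1_(W j) x)%:E))).
  rewrite ge0_integral_sum//; last 2 first.
    - by move=> j; apply/measurable_EFinP; apply: measurable_funM => //; exact: measurable_indic.
    - by move=> j x _; rewrite lee_fin mulr_ge0.
  apply: lee_sum => j _.
  rewrite (integralZl_indic (m := mu) measurableT (fun=> W j)) ?integral_indic ?setIT//.
  by rewrite ltNge al0.
apply: ge0_le_integralT => x; first by apply: sume_ge0 => j _; rewrite lee_fin mulr_ge0.
rewrite funenegE -EFinN -EFin_max sumEFin lee_fin le_max.
have [xD|xD] := pselect (D x); last first.
  have := Fle x; rewrite indicE memNset// mulr0 sub0r => h.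
  by apply/orP; left; rewrite lerNr.
rewrite big1 ?lexx ?orbT// => j _; rewrite indicE memNset ?mulr0// => Wx.
by have : (W j `&` D) x by []; rewrite WD.
Qed.

End integral_upper_bound.

(** * The equation at a contact point *)

Section anisotropic_weight.
Context {R : realType} {n : nat}.
Local Notation N := n.+1.
Variable sigma : 'I_N -> R.
Hypothesis sigma_bnd : forall i, 0 < sigma i < 2.

Definition weight (y : 'rV[R]_N) : R := \sum_i `|y ord0 i| `^ (N%:R + sigma i).

Lemma weight_ge0 y : 0 <= weight y.
Proof. by apply: sumr_ge0 => i _; exact: powR_ge0. Qed.

Lemma exponent_gt0 i : 0 < N%:R + sigma i.
Proof. by rewrite ltr_wpDl//; case/andP: (sigma_bnd i). Qed.

Lemma exponent_gtN i : N%:R < N%:R + sigma i.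
Proof. by rewrite ltrDl; case/andP: (sigma_bnd i). Qed.

Lemma exponent_ltN2 i : N%:R + sigma i < N%:R + 2.
Proof. by rewrite ltrD2l; case/andP: (sigma_bnd i). Qed.

(** The exponent is even, so the left side is a nonnegative polynomial, and it exceeds every
    [N + sigma i], so powers of numbers in the unit interval only decrease. *)
Lemma even_power_le_weight (y : 'rV[R]_N) : (forall i, `|y ord0 i| <= 1) ->
  \sum_i y ord0 i ^+ (2 * (N + 2)) <= weight y.
Proof.
move=> y1; apply: ler_sum => i _.
rewrite exprM -real_normK ?num_real// -exprM.
have [->|yi0] := eqVneq (y ord0 i) 0.
  by rewrite normr0 powR0 ?expr0n//= gt_eqF// exponent_gt0.
rewrite -powR_mulrn//; apply: ger_powR; first by rewrite normr_gt0 yi0 y1.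
apply: (le_trans (ltW (exponent_ltN2 i))).
by rewrite -natrD ler_nat leq_pmull.
Qed.

Lemma even_power_gt0 (y : 'rV[R]_N) : y != 0 -> 0 < \sum_i y ord0 i ^+ (2 * (N + 2)).
Proof.
have pos (i : 'I_N) : 0 <= y ord0 i ^+ (2 * (N + 2)) by rewrite exprM exprn_ge0// sqr_ge0.
move=> y0; rewrite lt_neqAle sumr_ge0 ?andbT//.
apply: contra y0 => /eqP/esym y0; apply/eqP/rowP => i; rewrite mxE; apply/eqP.
have /eqP := psumr_eq0P (fun i _ => pos i) y0 (i := i) isT.
by rewrite expf_eq0 => /andP[].
Qed.

End anisotropic_weight.

Section contact_point.
Context {R : realType} {n : nat}.
Local Notation N := n.+1.
Variable u : 'rV[R]_N -> R.
Hypothesis u_neg : forall x, ~ eball 0 1 x -> u x <= 0.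
Hypothesis u_usc : upper_semicontinuous_on (closure (eball 0 1)) u.
Variable x0 : 'rV[R]_N.
Hypothesis x0_contact : contact_set u (concave_envelope u) x0.
Local Notation Gamma := (concave_envelope u).

Let x01 : enorm x0 < 1. Proof. by case: x0_contact => /eball0P. Qed.
Let x0G : u x0 = Gamma x0. Proof. by case: x0_contact. Qed.
Let x03 : eball 0 3 x0. Proof. by apply/eball0P; have := x01; lra. Qed.

Lemma le_u_envelope x : eball 0 3 x -> u x <= Gamma x.
Proof. by move=> /(le_envelope u_neg u_usc); apply: le_trans; rewrite le_max lexx. Qed.

(** When both points lie in the ball of radius 3, this is concavity of [Gamma] combined with
    [u <= Gamma] and equality at [x0]. Otherwise both values of [u] are at most 0, while [u x0] is
    nonnegative. *)
Lemma second_diff_contact_le0 y : second_diff u x0 y <= 0.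
Proof.
have u0 : 0 <= u x0.
  by rewrite x0G (le_trans _ (le_envelope u_neg u_usc x03))// le_max lexx orbT.
(* If one of the two points x0 + y, x0 - y is outside B_3, then both are outside B_1. *)
have far (z w : 'rV[R]_N) : z + w = x0 + x0 -> ~ eball 0 3 z -> u z <= 0 /\ u w <= 0.
  move=> zw /eball0P z3.
  have hz : 3 <= enorm z by rewrite leNgt; apply/negP.
  have : enorm z <= enorm w + (enorm x0 + enorm x0).
    rewrite (_ : z = - w + (x0 + x0)); last by rewrite -zw addrC addrK.
    by rewrite (le_trans (ler_enormD _ _))// enormN lerD2l ler_enormD.
    have x0lt := x01.
  move=> hw; split; apply: u_neg => /eball0P; lra.
have e1 : (x0 + y) + (x0 - y) = x0 + x0 by rewrite addrACA subrr addr0.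
rewrite /second_diff.
have [p3|/(far _ _ e1)] := pselect (eball 0 3 (x0 + y)); last by lra.
have [m3|] := pselect (eball 0 3 (x0 - y)); last first.
  by rewrite addrC in e1; move/(far _ _ e1); lra.
have := envelope_midpoint u_neg u_usc x03 p3 m3 e1.
have := le_u_envelope p3; have := le_u_envelope m3; rewrite x0G; lra.
Qed.

Lemma superdifferential_contact b y : superdifferential Gamma x0 b ->
  eball 0 3 y -> u y <= u x0 + dot b (y - x0).
Proof.
by move=> [_ bP] y3; rewrite (le_trans (le_u_envelope y3))// x0G; exact: bP.
Qed.

End contact_point.

Section viscosity_contact.
Context {R : realType} {n : nat}.
Local Notation N := n.+1.
Variables (lambda Lambda : R) (sigma : 'I_N -> R) (f u : 'rV[R]_N -> R).
Hypothesis lambda0 : 0 < lambda.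
Hypothesis lambdaLambda : lambda <= Lambda.
Hypothesis sigma_bnd : forall i, 0 < sigma i < 2.
Hypothesis c0 : 0 < c_ sigma.
Hypothesis u_neg : forall x, ~ eball 0 1 x -> u x <= 0.
Hypothesis u_sub : viscosity_subsolution (Mplus sigma lambda Lambda) (eball 0 1)
  (fun x => - f x) u.
Variable x0 : 'rV[R]_N.
Hypothesis x0_contact : contact_set u (concave_envelope u) x0.

(* The test function is the supporting plane plus a small multiple of
   [\sum_i (y_i - x0_i)^(2(N+2))], which vanishes at x0 to such a high order
   that its second difference times the kernel is bounded. *)
Lemma viscosity_test_function (J : nat) (al : 'I_J -> R) (W : 'I_J -> set 'rV[R]_N)
    (r eps : R) :
  (forall j, 0 <= al j) ->
  (forall j, measurable (W j : set (lebesgue_rV_type R N))) ->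
  0 < r -> r <= 1 - enorm x0 -> 0 < eps ->
  (forall j, W j `&` cbox 0 (const_mx r) = set0) ->
  (forall y, \sum_j al j * \1_(W j) y <=
             lambda * - second_diff u x0 y / weight sigma y) ->
  ((- f x0)%:E <= (c_ sigma)%:E * ((2 * Lambda * eps * (2 * r) ^+ N)%:E -
     \sum_j (al j)%:E * lebesgue_rV (W j)))%E.
Proof.
move=> al0 mW r0 rx0 eps0 WD alW.
have [u_usc uJ] := u_sub.
have [/eball0P x01 x0G] := x0_contact.
have en0 := enorm_ge0 x0.
have L0 : 0 <= Lambda by rewrite ltW// (lt_le_trans lambda0).
have e00 := ltW eps0.
have [b bP] := superdifferential_neq0 u_neg u_usc x0_contact.1.
pose m := (2 * (N + 2))%N.
pose P i : {poly R} := (b ord0 i)%:P * ('X - (x0 ord0 i)%:P) +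
   eps%:P * ('X - (x0 ord0 i)%:P) ^+ m.
pose phi (y : 'rV[R]_N) := u x0 + \sum_i (P i).[y ord0 i].
have phiE y : phi y = u x0 + dot b (y - x0) +
    eps * \sum_i (y - x0) ord0 i ^+ m.
  rewrite /phi -addrA; congr (_ + _); rewrite mulr_sumr -big_split.
  by apply: eq_bigr => i _; rewrite /P !hornerE !mxE.
have sub1 : eball x0 r `<=` eball 0 1.
  move=> y; rewrite /eball /= subr0 => yr.
  rewrite -(subrK x0 y); apply: le_lt_trans (ler_enormD _ _) _; lra.
have phix0 : phi x0 = u x0.
  rewrite phiE subrr dotr0 addr0 big1 ?mulr0 ?addr0// => i _.
  by rewrite mxE expr0n.
apply: (le_trans (uJ x0 r phi x0_contact.1 r0 sub1 _ phix0 _)).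
- by exists setT; split => //; [exact: openT|exact: Ck_separable_polynomial].
- move=> y yr yx0.
  have y3 : eball 0 3 y by move/sub1/eball0P : yr => ?; apply/eball0P; lra.
  apply: (le_lt_trans (superdifferential_contact u_neg u_usc x0_contact bP y3)).
  rewrite phiE ltrDl mulr_gt0//; apply: even_power_gt0.
  by rewrite subr_eq0; exact/eqP.
rewrite /Mplus; apply: lee_wpmul2l; first by rewrite lee_fin ltW.
set v := patch u (eball x0 r) phi.
have DE : lebesgue_rV (cbox (0 : 'rV[R]_N) (const_mx r)) = ((2 * r) ^+ N)%:E.
  by rewrite lebesgue_rV_cbox ?prod_cube// => i; rewrite mxE ltW.
rewrite [(_ * (2 * r) ^+ N)%:E]EFinM -DE.
apply: integral_le_indic => //.
- by rewrite !mulr_ge0.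
- by apply: measurable_lebesgue_rV; exact: measurable_cbox.
move=> y; rewrite -/(weight sigma y).
have vx0 : v x0 = u x0.
  by rewrite /v /patch mem_set// /eball /= subrr enorm0.
have sum0 : 0 <= \sum_j al j * \1_(W j) y.
  by apply: sumr_ge0 => j _; rewrite mulr_ge0.
have w0 := weight_ge0 sigma y.
have Dsum0 : cbox 0 (const_mx r) y -> \sum_j al j * \1_(W j) y = 0.
  move=> Dy; rewrite big1// => j _; rewrite indicE memNset ?mulr0// => Wy.
  by have : (W j `&` cbox 0 (const_mx r)) y by []; rewrite WD.
(* For [y] in the ball of radius [r] the affine part cancels and twice the even power remains;
   outside it, both points carry the values of [u] and the second difference is that of [u]. *)
have [yr|yr] := ltP (enorm y) r.
  have yi i : `|y ord0 i| < r by exact: le_lt_trans (ler_coord_enorm _ _) yr.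
  have Dy : cbox 0 (const_mx r) y by move=> i; rewrite !mxE subr0 ltW.
  rewrite Dsum0// subr0 indicE mem_set// mulr1.
  have -> : second_diff v x0 y = 2 * (eps * \sum_i y ord0 i ^+ m).
    rewrite /second_diff vx0 /v /patch !mem_set/=; last 2 first.
    - by rewrite /eball /= addrAC subrr add0r enormN.
    - by rewrite /eball /= addrAC subrr add0r.
    rewrite !phiE ![x0 + _ - x0]addrAC subrr !add0r dotNr.
    have -> : \sum_i (- y) ord0 i ^+ m = \sum_i y ord0 i ^+ m.
      by apply: eq_bigr => i _; rewrite /m !exprM mxE sqrrN.
    ring.
  set e := \sum_i _.
  have e0 : 0 <= e by apply: sumr_ge0 => i _; rewrite /m exprM exprn_ge0// sqr_ge0.
  have ew : e <= weight sigma y.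
    apply: even_power_le_weight => // i; rewrite (le_trans (ltW (yi i)))//; lra.
  have ee0 : 0 <= 2 * (eps * e) by rewrite !mulr_ge0.
  rewrite (max_idPl ee0) (max_idPr _) ?oppr_le0// mulr0 subr0.
  (* Where the weight vanishes, the kernel has the default value 0. *)
  have [->|wn0] := eqVneq (weight sigma y) 0.
    by rewrite invr0 mulr0 !mulr_ge0.
  rewrite ler_pdivrMr; last by rewrite lt_neqAle eq_sym wn0.
  have : Lambda * eps * e <= Lambda * eps * weight sigma y.
    by rewrite ler_wpM2l// mulr_ge0.
  lra.
have S0 := second_diff_contact_le0 u_neg u_usc x0_contact y.
have -> : second_diff v x0 y = second_diff u x0 y.
  rewrite /second_diff vx0 /v /patch !memNset//= /eball /=.
    by rewrite addrAC subrr add0r enormN; apply/negP; rewrite -leNgt.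
  by rewrite addrAC subrr add0r; apply/negP; rewrite -leNgt.
rewrite (max_idPr S0) mulr0 sub0r (max_idPl _) ?oppr_ge0//.
apply: (@le_trans _ _ (- \sum_j al j * \1_(W j) y)).
  by rewrite mulNr lerN2; exact: alW.
by rewrite lerDr !mulr_ge0.
Qed.

(** The limit [eps -> 0] of the preceding bound. The radius is also cut down to [1 - enorm x0] to
    keep the test ball inside the unit ball. *)
Lemma viscosity_contact_bound (J : nat) (al : 'I_J -> R) (W : 'I_J -> set 'rV[R]_N)
    (rho : R) :
  (forall j, 0 <= al j) ->
  (forall j, measurable (W j : set (lebesgue_rV_type R N))) ->
  0 < rho -> (forall j, W j `&` cbox 0 (const_mx rho) = set0) ->
  (forall y, \sum_j al j * \1_(W j) y <=
             lambda * - second_diff u x0 y / weight sigma y) ->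
  ((c_ sigma)%:E * (\sum_j (al j)%:E * lebesgue_rV (W j)) <= (f x0)%:E)%E.
Proof.
move=> al0 mW rho0 WD alW.
have [/eball0P x01 x0G] := x0_contact.
pose r := Num.min rho (1 - enorm x0).
have r0 : 0 < r by rewrite lt_min rho0; lra.
have WD' j : W j `&` cbox 0 (const_mx r) = set0.
  rewrite -subset0 -(WD j); apply: setIS => y /= yr i.
  by have := yr i; rewrite !mxE => /le_trans -> //; rewrite ge_min lexx.
have r1 : r <= 1 - enorm x0 by rewrite ge_min lexx orbT.
have T eps (eps0 : 0 < eps) := viscosity_test_function al0 mW r0 r1 eps0 WD' alW.
have X0 : (0 <= \sum_j (al j)%:E * lebesgue_rV (W j))%E.
  by apply: sume_ge0 => j _; rewrite mule_ge0// lee_fin.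
move: T X0; set X := (\sum_j _)%E => T X0.
(* An infinite sum would make the right side of the bound for [eps = 1] equal to [-oo]. *)
case: X T X0 => [X|T _|//]; last first.
  by have := T 1 ltr01; rewrite addeNy// mulrNy gtr0_sg// mul1e leeNy_eq.
move=> T X0; rewrite -EFinM lee_fin; apply/ler_addgt0Pr => e e0.
pose K := c_ sigma * (2 * Lambda * (2 * r) ^+ N).
have K0 : 0 < K.
  by rewrite /K !mulr_gt0// ?exprn_gt0 ?mulr_gt0//; exact: (lt_le_trans lambda0).
have := T (e / K) (divr_gt0 e0 K0).
rewrite -EFinB -EFinM lee_fin.
have -> : 2 * Lambda * (e / K) * (2 * r) ^+ N = e / c_ sigma.
  rewrite {}/K in K0 *; move: ((2 * r) ^+ N) K0 => q K0.
  have [q0 L0] : q != 0 /\ Lambda != 0.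
    by split; apply: contraTneq K0 => ->; rewrite ?(mulr0, mul0r) ltxx.
  by field; rewrite q0 L0 gt_eqF.
rewrite mulrBr mulrCA mulfV ?mulr1 ?gt_eqF//; lra.
Qed.

End viscosity_contact.

(** * Scales *)

Lemma prod_powR (R : realType) (I : finType) (a : R) (e : I -> R) : 0 < a ->
  \prod_i a `^ e i = a `^ (\sum_i e i).
Proof.
move=> a0; elim/big_rec2 : _ => [|i x y _ ->]; first by rewrite powRr0.
by rewrite powRD// (gt_eqF a0) implybT.
Qed.

(* Such a sum is at most twice its largest term. *)
Lemma sum_doubling_le (R : realType) (c : nat -> R) (M : R) (J : nat) :
  0 <= M -> (forall j, 0 <= c j) -> (forall j, 2 * c j <= c j.+1) ->
  \sum_(j < J | c j < M) c j <= 2 * M.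
Proof.
move=> M0 c0 c2.
have sumc k : \sum_(j < k | c j < M) c j <= c k.
  elim: k => [|k IH]; first by rewrite big_ord0.
  rewrite big_mkcond big_ord_recr -big_mkcond/= (le_trans _ (c2 k))// mulrDl mul1r.
  by apply: lerD => //; case: ifP.
elim: J => [|J IH]; first by rewrite big_ord0 mulr_ge0.
rewrite big_mkcond big_ord_recr -big_mkcond/=.
case: ifPn => [cJ|_]; last by rewrite addr0.
by rewrite mulrDl mul1r lerD// ?(ltW cJ)// (le_trans (sumc J))// ltW.
Qed.

Section scales.
Context {R : realType} {n : nat}.
Local Notation N := n.+1.
Variable sigma : 'I_N -> R.
Hypothesis sigma_bnd : forall i, 0 < sigma i < 2.

Definition pmin : R := N%:R + sigma_min sigma.

Lemma sigma_min_le i : sigma_min sigma <= sigma i.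
Proof. exact: bigmin_le. Qed.

Lemma sigma_min_attained : exists i, sigma_min sigma = sigma i.
Proof.
rewrite /sigma_min; elim/big_ind : _ => [|x y [i ->] [j ->]|i _]; [by exists ord0| |by exists i].
by rewrite minEle; case: ifP => _; [exists i|exists j].
Qed.

Lemma pmin_gtN : N%:R < pmin.
Proof. by rewrite /pmin; have [i ->] := sigma_min_attained; exact: exponent_gtN. Qed.

Lemma pmin_gt0 : 0 < pmin.
Proof. by rewrite (le_lt_trans _ pmin_gtN). Qed.

Lemma pmin_lt : pmin < N%:R + 2.
Proof. by rewrite /pmin; have [i ->] := sigma_min_attained; exact: exponent_ltN2. Qed.

Lemma pmin_le i : pmin <= N%:R + sigma i.
Proof. by rewrite lerD2l sigma_min_le. Qed.

(** The exponents of the anisotropic dilation for which [weight] is homogeneous of degree [pmin].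
    The exponent is 1 in a direction of smallest [sigma i]. *)
Definition aexp i : R := pmin / (N%:R + sigma i).

Lemma aexp_gt0 i : 0 < aexp i.
Proof. by rewrite divr_gt0 ?pmin_gt0 ?exponent_gt0. Qed.

Lemma aexp_le1 i : aexp i <= 1.
Proof. by rewrite ler_pdivrMr ?exponent_gt0// mul1r pmin_le. Qed.

(* The half-sides of the box [\tilde R] of the paper at radius [a^pmin], so that
   the shortest one is [a]. *)
Definition awidth (a : R) : 'rV[R]_N := \row_i a `^ aexp i.

Lemma awidth_ge0 a i : 0 <= awidth a ord0 i.
Proof. by rewrite mxE powR_ge0. Qed.

Lemma le_awidth a i : 0 < a <= 1 -> a <= awidth a ord0 i.
Proof. by move=> a01; rewrite mxE ger1_powR// aexp_le1. Qed.

Lemma lt_weight_awidth a y : 0 < a -> obox 0 (awidth a) y ->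
  weight sigma y < N%:R * a `^ pmin.
Proof.
move=> a0 ya.
rewrite (_ : N%:R * _ = \sum_(i < N) a `^ pmin); last first.
  by rewrite sumr_const card_ord mulr_natl.
apply: ltr_sum; first by apply/hasP; exists ord0; rewrite ?mem_index_enum.
move=> i _; have := ya i; rewrite !mxE subr0 => yi.
have -> : a `^ pmin = (a `^ aexp i) `^ (N%:R + sigma i).
  by rewrite -powRrM divfK// gt_eqF// exponent_gt0.
by rewrite gt0_ltr_powR ?nnegrE ?powR_ge0//; exact: exponent_gt0.
Qed.

Definition box_volume (a : R) : R := 2 ^+ N * a `^ (\sum_i aexp i).

Lemma box_volume_gt0 a : 0 < a -> 0 < box_volume a.
Proof. by move=> a0; rewrite mulr_gt0 ?exprn_gt0// powR_gt0. Qed.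

Lemma prod_awidth a k : 0 < a ->
  \prod_i (2 * (k *: awidth a) ord0 i) = k ^+ N * box_volume a.
Proof.
move=> a0; rewrite /box_volume -prod_powR//.
under eq_bigr => i _ do rewrite !mxE mulrA.
by rewrite big_split/= prodr_const card_ord exprMn mulrA (mulrC (k ^+ N)).
Qed.

Lemma lebesgue_rV_awidth c a k : 0 < a -> 0 <= k ->
  lebesgue_rV (obox c (k *: awidth a)) = (k ^+ N * box_volume a)%:E.
Proof.
move=> a0 k0; rewrite lebesgue_rV_obox ?prod_awidth// => i.
by rewrite !mxE mulr_ge0// powR_ge0.
Qed.

Definition qexp : R := 2 - pmin + \sum_i aexp i.

Lemma box_volume_scale a : 0 < a ->
  a ^+ 2 * box_volume a / a `^ pmin = 2 ^+ N * a `^ qexp.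
Proof.
move=> a0; rewrite /box_volume /qexp.
have h : a != 0 by rewrite gt_eqF.
rewrite (@powRD _ a (2 - pmin)) ?h ?implybT// (@powRB _ a 2 pmin) ?h ?implybT//.
rewrite (powR_mulrn 2 (ltW a0)).
by ring.
Qed.

(** The excess of [1 / (N + sigma i)] over its value at [sigma i = 2]. Since
    [1 = N / (N + 2) + 2 / (N + 2)], the constant [-1] in [q_] is absorbed exactly; so every
    [q_ sigma i] lies between the sum of all [D j] and three times that sum. *)
Let D i : R := 1 / (N%:R + sigma i) - 1 / (N%:R + 2).

Let D_gt0 i : 0 < D i.
Proof.
by rewrite subr_gt0 !div1r ltf_pV2 ?posrE ?exponent_gt0 ?exponent_ltN2// ltr_wpDl.
Qed.

Let q_E i : q_ sigma i = \sum_j D j + 2 * D i.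
Proof.
have N2 : N%:R + 2 != 0 :> R by rewrite gt_eqF// ltr_wpDl.
have -> : \sum_j D j = \sum_j 1 / (N%:R + sigma j) - N%:R / (N%:R + 2).
  rewrite sumrB; congr (_ - _).
  by rewrite sumr_const card_ord -[LHS]mulr_natl mulrA mulr1.
rewrite [in RHS](bigD1 i)//= /q_ /D.
have -> : 3 / (N%:R + sigma i) = 1 / (N%:R + sigma i) + 2 / (N%:R + sigma i).
  by rewrite -mulrDl.
move: (\sum_(j < N | j != i) _) => s.
have E0 : N%:R + sigma i != 0 by rewrite gt_eqF// exponent_gt0.
rewrite (_ : N%:R / (N%:R + 2) = 1 - 2 / (N%:R + 2)); last first.
  by apply: (mulIf N2); rewrite mulrBl !divfK// mul1r addrK.
move: (N%:R + sigma i) (N%:R + 2) E0 N2 => E M E0 M0; field.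
by rewrite E0 M0.
Qed.

Let sumD_gt0 : 0 < \sum_j D j.
Proof.
by rewrite (bigD1 ord0)//= ltr_wpDr ?D_gt0// sumr_ge0// => i _; rewrite ltW.
Qed.

Lemma q_gt0 i : 0 < q_ sigma i.
Proof. by rewrite q_E addr_gt0 ?mulr_gt0. Qed.

Lemma q_le3 i j : q_ sigma i <= 3 * q_ sigma j.
Proof.
have Di : D i <= \sum_k D k.
  by rewrite (bigD1 i)//= lerDl sumr_ge0// => k _; rewrite ltW.
by rewrite !q_E; have := D_gt0 j; have := sumD_gt0; lra.
Qed.

Lemma qexpE i : sigma_min sigma = sigma i -> qexp = pmin * q_ sigma i.
Proof.
move=> smin; have p0 := pmin_gt0.
have e1 : aexp i = 1 by rewrite /aexp -smin -/pmin divff ?gt_eqF.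
rewrite /qexp (bigD1 i)//= e1 /q_ -smin -/pmin.
have -> : \sum_(j | j != i) aexp j = pmin * \sum_(j | j != i) 1 / (N%:R + sigma j).
  by rewrite mulr_sumr; apply: eq_bigr => j _; rewrite /aexp mulrA mulr1.
by field; rewrite gt_eqF.
Qed.

Lemma qexp_gt0 : 0 < qexp.
Proof.
have [i smin] := sigma_min_attained.
by rewrite (qexpE smin) mulr_gt0 ?pmin_gt0 ?q_gt0.
Qed.

Lemma c_sigma_gt0 : 0 < c_ sigma.
Proof. exact: q_gt0. Qed.

(** Both quantities tend to 0 as all [sigma i] tend to 2. This comparison makes the later constants
    uniform: the factor 3 compares two values of [q_], and [N + 2] bounds [pmin]. *)
Lemma qexp_le_c_sigma : qexp <= 3 * (N%:R + 2) * c_ sigma.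
Proof.
have [i smin] := sigma_min_attained.
rewrite (qexpE smin) [leRHS]mulrAC [leRHS]mulrC.
by apply: ler_pM; [exact/ltW/pmin_gt0|exact/ltW/q_gt0|exact/ltW/pmin_lt|exact: q_le3].
Qed.

Lemma qexp_le_qmax : qexp <= pmin * q_max sigma.
Proof.
have [i smin] := sigma_min_attained.
rewrite (qexpE smin) ler_pM2l ?pmin_gt0//; exact: le_bigmax.
Qed.

Lemma qmax_gt0 : 0 < q_max sigma.
Proof. apply: (lt_le_trans (q_gt0 ord0)); exact: le_bigmax. Qed.

(** The [N] terms [1 / (N + sigma j)] sum to at most 1, which cancels [-1]; what remains is
    [2 / (N + sigma i)]. *)
Lemma qmax_le2 : q_max sigma <= 2.
Proof.
rewrite /q_max; have bnd i : q_ sigma i <= 2.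
  have inv j : 1 / (N%:R + sigma j) <= N%:R^-1.
    by rewrite div1r lef_pV2 ?posrE ?exponent_gt0// ltW// exponent_gtN.
  have N1 : N%:R^-1 <= 1 :> R by rewrite invf_le1// ler1n.
  have : \sum_j 1 / (N%:R + sigma j) <= 1.
    apply: (le_trans (ler_sum _ (fun j _ => inv j))).
    by rewrite sumr_const card_ord -[leLHS]mulr_natl mulfV.
  rewrite (bigD1 i)//= /q_; have := inv i.
  move: (\sum_(j < N | j != i) _) => s h1 h2.
  have -> : 3 / (N%:R + sigma i) = 3 * (1 / (N%:R + sigma i)) by rewrite mulrA mulr1.
  by move: (1 / (N%:R + sigma i)) (N%:R^-1) h1 h2 N1 => t v; lra.
by apply/bigmax_leP; split => // i _; exact: bnd.
Qed.

End scales.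

(* So small that a bad set and its reflection cannot cover a box of half the size. *)
Definition bad_frac {R : realType} (n : nat) : R := (4 * 2 ^+ n.+1)^-1.

Lemma bad_frac_gt0 (R : realType) n : 0 < bad_frac n :> R.
Proof. by rewrite invr_gt0 mulr_gt0 ?exprn_gt0. Qed.

(** * Existence of a good scale at each contact point *)

Section good_scale.
Context {R : realType} {n : nat}.
Local Notation N := n.+1.
Variables (lambda Lambda : R) (sigma : 'I_N -> R) (f u : 'rV[R]_N -> R).
Hypothesis lambda0 : 0 < lambda.
Hypothesis lambdaLambda : lambda <= Lambda.
Hypothesis sigma_bnd : forall i, 0 < sigma i < 2.
Hypothesis u_meas : measurable_fun [set: lebesgue_rV_type R N] u.
Hypothesis u_neg : forall x, ~ eball 0 1 x -> u x <= 0.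
Hypothesis u_sub : viscosity_subsolution (Mplus sigma lambda Lambda) (eball 0 1)
  (fun x => - f x) u.
Variable x0 : 'rV[R]_N.
Hypothesis x0_contact : contact_set u (concave_envelope u) x0.

Definition bad_set (a h : R) : set 'rV[R]_N :=
  [set y | obox 0 (awidth sigma a) y /\ h < - second_diff u x0 y].

Lemma measurable_comp_pointrefl (g : 'rV[R]_N -> R) c :
  measurable_fun [set: lebesgue_rV_type R N] g ->
  measurable_fun [set: lebesgue_rV_type R N] (g \o pointrefl c).
Proof.
move=> mg _ Y mY; have := mg measurableT Y mY; rewrite !setTI => mgY.
by have := measurable_pointrefl_completed c measurableT mgY; rewrite setTI.
Qed.

Lemma measurable_second_diff :
  measurable_fun [set: lebesgue_rV_type R N] (second_diff u x0).
Proof.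
pose T : measurableType _ := lebesgue_rV_type R N.
have m1 := measurable_comp_pointrefl x0 u_meas.
have m2 := measurable_comp_pointrefl 0 m1.
have E : second_diff u x0 =
    (((u \o pointrefl x0) \o pointrefl 0) \+ (u \o pointrefl x0)) \- cst (2 * u x0).
  by apply/funext => y; rewrite /= /pointrefl sub0r opprK.
rewrite E.
exact: (@measurable_funB _ T R setT _ _ (@measurable_funD _ T R setT _ _ m2 m1)
  (measurable_cst (2 * u x0))).
Qed.

Lemma measurable_bad_set a h : measurable (bad_set a h : set (lebesgue_rV_type R N)).
Proof.
apply: (@measurableI _ (lebesgue_rV_type R N)).
  by apply: measurable_lebesgue_rV; exact: measurable_obox.
rewrite [X in measurable X](_ : _ =
    setT `&` second_diff u x0 @^-1` `]-oo, (- h)[%classic).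
  by apply: measurable_second_diff => //; exact: measurable_itv.
by rewrite setTI; apply/seteqP; split => y /=; rewrite in_itv/= ltrNr.
Qed.

Let ge0_sd y : 0 <= - second_diff u x0 y.
Proof. by rewrite oppr_ge0; exact: (second_diff_contact_le0 u_neg u_sub.1 x0_contact). Qed.

(** The contact bound with the empty family of sets. *)
Lemma rhs_contact_ge0 : 0 <= f x0.
Proof.
have c0 := c_sigma_gt0 sigma_bnd.
have := @viscosity_contact_bound R n lambda Lambda sigma f u lambda0 lambdaLambda
  sigma_bnd c0 u_neg u_sub x0 x0_contact 0 (fun=> 0) (fun=> set0) 1.
rewrite big_ord0 mule0 lee_fin; apply => // [[]//|y].
by rewrite big_ord0 divr_ge0 ?weight_ge0// mulr_ge0// ltW.
Qed.

Variables (a0 A : R) (J : nat).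
Hypothesis a0_gt0 : 0 < a0.
Hypothesis A_gt0 : 0 < A.
Hypothesis sum_scales : 16 * N%:R <=
  c_ sigma * lambda * A * \sum_(j < J) (a0 / 2 ^+ j) `^ qexp sigma.

Let a (j : nat) := a0 / 2 ^+ j.
Let a_gt0 j : 0 < a j. Proof. by rewrite divr_gt0 ?exprn_gt0. Qed.

(** The contact bound asks for sets away from the origin. This cube is removed from every bad set
    and costs at most half of the critical measure at each of the [J] scales. *)
Let small_cube : exists2 rho : R, 0 < rho & forall j, (j < J)%N ->
  (2 * rho) ^+ N <= bad_frac n / 2 * box_volume sigma (a j).
Proof.
pose V := box_volume sigma (a J).
have V0 : 0 < bad_frac n / 2 * V by rewrite mulr_gt0 ?divr_gt0 ?bad_frac_gt0 ?box_volume_gt0.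
exists (Num.min 1 (bad_frac n / 2 * V) / 2); first by rewrite divr_gt0// lt_min ltr01 V0.
move=> j jJ; rewrite mulrC divfK//.
have m0 : 0 <= Num.min 1 (bad_frac n / 2 * V) by rewrite le_min ler01 ltW.
apply: (@le_trans _ _ (bad_frac n / 2 * V)).
  apply: (@le_trans _ _ (Num.min 1 (bad_frac n / 2 * V))); last by rewrite ge_min lexx orbT.
  by rewrite exprS ler_piMr// exprn_ile1// ge_min lexx.
rewrite ler_pM2l ?divr_gt0 ?bad_frac_gt0// ler_pM2l ?exprn_gt0//.
rewrite ge0_ler_powR ?nnegrE ?(ltW (a_gt0 _))//.
  by rewrite sumr_ge0// => i _; rewrite ltW// aexp_gt0.
by rewrite ler_pM2l// lef_pV2 ?posrE ?exprn_gt0// ler_eXn2l ?ltr1n// ltnW.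
Qed.

Let inv_scale_doubling j : 2 * (a j `^ pmin sigma)^-1 <= (a j.+1 `^ pmin sigma)^-1.
Proof.
rewrite -!powRN.
have -> : a j = a j.+1 * 2.
  by rewrite /a exprSr; field; rewrite expf_neq0.
have p1 : 1 <= pmin sigma.
  by rewrite (le_trans _ (ltW (pmin_gtN sigma_bnd)))// ler1n.
rewrite powRM// ?(ltW (a_gt0 _))// mulrCA ger_pMr ?powR_gt0//.
rewrite powRN ler_pdivrMr ?powR_gt0// mul1r.
by rewrite le1r_powR// ler1n.
Qed.

(** Pigeonhole: if the bad set were large at every scale, the weighted sum of their measures would
    exceed [f x0]. A positive [eta] keeps the thresholds positive and the contradiction strict even
    when [f x0 = 0]. *)
Lemma good_scale_eps (eta : R) : 0 < eta ->
  exists j : 'I_J, (lebesgue_rV (bad_set (a j) (A * (f x0 + eta) * a j ^+ 2)) <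
    (bad_frac n * box_volume sigma (a j))%:E)%E.
Proof.
move=> eta0.
have c0 := c_sigma_gt0 sigma_bnd.
have f0 := rhs_contact_ge0.
have [rho rho0 rhoP] := small_cube.
apply: contrapT => /forallNP noj.
pose h j := A * (f x0 + eta) * a j ^+ 2.
have fe0 : 0 < f x0 + eta by rewrite ltr_wpDl.
have h0 j : 0 < h j by rewrite !mulr_gt0 ?exprn_gt0.
pose W (j : 'I_J) := bad_set (a j) (h j) `\` cbox 0 (const_mx rho).
(* In the denominator, [N] comes from the bound of the weight on a box and 2 from the sum over the
   scales whose box contains a given point. *)
pose al (j : 'I_J) := lambda * h j / (2 * N%:R * a j `^ pmin sigma).
have p0 j : 0 < a j `^ pmin sigma by rewrite powR_gt0.
have al0 j : 0 <= al j.
  by apply/ltW/divr_gt0; rewrite !mulr_gt0 ?lambda0 ?h0 ?p0 ?ltr0n ?fe0.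
have mcb : measurable (cbox 0 (const_mx rho) : set (lebesgue_rV_type R N)).
  by apply: measurable_lebesgue_rV; exact: measurable_cbox.
have mW j : measurable (W j : set (lebesgue_rV_type R N)).
  by apply: measurableD => //; exact: measurable_bad_set.
have WD j : W j `&` cbox 0 (const_mx rho) = set0.
  by rewrite -subset0 => y [[_ nD] /nD].
have alW y : \sum_j al j * \1_(W j) y <=
    lambda * - second_diff u x0 y / weight sigma y.
  have S0 := ge0_sd y; have w0 := weight_ge0 sigma y.
  have [y0|y0] := pselect (cbox 0 (const_mx rho) y).
    rewrite big1 ?divr_ge0 ?mulr_ge0 ?(ltW lambda0)// => j _.
    by rewrite indicE memNset ?mulr0// => -[].
  have {}w0 : 0 < weight sigma y.
    rewrite lt_neqAle w0 andbT eq_sym; apply: contra_notN y0 => /eqP wy i.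
    rewrite !mxE subr0; have /eqP := psumr_eq0P (fun i _ => powR_ge0 _ _) wy (i := i) isT.
    by rewrite powR_eq0 => /andP[/eqP -> _]; rewrite ltW.
  (* If [y] lies in the box of scale [a j], then the weight is below [N] times the [pmin]-th power
     of [a j]. So only inverse powers below [N / weight] occur, and as they at least double with
     [j], their sum is at most [2 * N / weight]. *)
  apply: (@le_trans _ _ (lambda * - second_diff u x0 y / (2 * N%:R) *
      \sum_(j < J | (a j `^ pmin sigma)^-1 < N%:R / weight sigma y)
         (a j `^ pmin sigma)^-1)).
    rewrite mulr_sumr [leRHS]big_mkcond; apply: ler_sum => j _.
    have [Wy|Wy] := pselect (W j y); last first.
      rewrite indicE memNset// mulr0; case: ifP => // _.
      by rewrite mulr_ge0 ?divr_ge0 ?mulr_ge0 ?invr_ge0 ?(ltW lambda0) ?(ltW (p0 _)).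
    have [[yj hy] _] := Wy.
    rewrite ifT; last first.
      rewrite -[ltLHS]mul1r ltr_pdivrMr// mulrAC ltr_pdivlMr// mul1r.
      exact: lt_weight_awidth.
    rewrite indicE mem_set// mulr1 /al invfM mulrA ler_wpM2r ?invr_ge0 ?(ltW (p0 _))//.
    by rewrite ler_wpM2r ?invr_ge0 ?mulr_ge0// ler_wpM2l ?(ltW lambda0) ?(ltW hy).
  have := @sum_doubling_le R (fun j => (a j `^ pmin sigma)^-1)
    (N%:R / weight sigma y) J.
  move=> /(_ (divr_ge0 (ler0n _ _) (ltW w0))) sumle.
  have ip0 j : 0 <= (a j `^ pmin sigma)^-1 by rewrite invr_ge0 ltW.
  have {}sumle := sumle ip0 inv_scale_doubling.
  apply: (le_trans (ler_wpM2l _ sumle)); first by rewrite divr_ge0 ?mulr_ge0 ?(ltW lambda0).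
  have N0 : N%:R != 0 :> R by [].
  have wn := lt0r_neq0 w0.
  rewrite le_eqVlt; apply/orP; left; apply/eqP.
  by move: (N%:R) (weight sigma y) (second_diff u x0 y) N0 wn => M w S N0 wn; field; rewrite N0 wn.
have := @viscosity_contact_bound R n lambda Lambda sigma f u lambda0 lambdaLambda
  sigma_bnd c0 u_neg u_sub x0 x0_contact J al W rho al0 mW rho0 WD alW.
apply/negP; rewrite -ltNge.
have Wlow (j : 'I_J) : ((bad_frac n / 2 * box_volume sigma (a j))%:E <= lebesgue_rV (W j))%E.
  have rE : lebesgue_rV (cbox (0 : 'rV[R]_N) (const_mx rho)) = ((2 * rho) ^+ N)%:E.
    by rewrite lebesgue_rV_cbox ?prod_cube// => i; rewrite mxE ltW.
  have Wj : (lebesgue_rV (bad_set (a j) (h j)) <=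
      lebesgue_rV (W j) + ((2 * rho) ^+ N)%:E)%E.
    rewrite -rE; apply: le_trans (lebesgue_rVU _ _); apply: le_lebesgue_rV => y yb.
    by have [?|?] := pselect (cbox 0 (const_mx rho) y); [right|left].
  have /negP := noj j; rewrite -leNgt => /le_trans/(_ Wj).
  rewrite -leeBlDr//; apply: le_trans; rewrite -EFinB lee_fin.
  have := rhoP j (ltn_ord j); lra.
apply: (@lt_le_trans _ _ ((c_ sigma)%:E *
    \sum_(j < J) (al j)%:E * (bad_frac n / 2 * box_volume sigma (a j))%:E)%E); last first.
  apply: lee_wpmul2l; first by rewrite lee_fin ltW.
  by apply: lee_sum => j _; apply: lee_wpmul2l; rewrite ?lee_fin.
under eq_bigr => j _ do rewrite -EFinM.
rewrite sumEFin -EFinM lte_fin.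
(* The factor 16 collects the 2 in [al], the 2 for the removed cube and the 4 in [bad_frac]; the
   powers of 2 in [bad_frac] and in the box volume cancel. Then [sum_scales] bounds the total from
   below by [f x0 + eta]. *)
have -> : \sum_(j < J) al j * (bad_frac n / 2 * box_volume sigma (a j)) =
    lambda * A * (f x0 + eta) / (16 * N%:R) *
    \sum_(j < J) (a j) `^ qexp sigma.
  rewrite mulr_sumr; apply: eq_bigr => j _.
  have E := box_volume_scale sigma (a_gt0 j).
  have t0 : (2 : R) ^+ N != 0 by rewrite expf_neq0.
  have -> : a j `^ qexp sigma =
      a j ^+ 2 * box_volume sigma (a j) / a j `^ pmin sigma / 2 ^+ N.
    by rewrite E mulrC mulKf.
  rewrite /al /h /bad_frac.
  have pj := lt0r_neq0 (p0 j); have N0 : N%:R != 0 :> R by [].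
  move: (a j `^ pmin sigma) (box_volume sigma (a j)) (2 ^+ N) (N%:R) pj t0 N0.
  move=> p v t M p00 t0 M0; field.
  by rewrite p00 t0 M0.
apply: (@lt_le_trans _ _ (f x0 + eta)); first by rewrite ltrDl.
have M0 : 0 < 16 * N%:R :> R by rewrite mulr_gt0.
have -> : c_ sigma * (lambda * A * (f x0 + eta) / (16 * N%:R) *
     \sum_(j < J) a j `^ qexp sigma) = (f x0 + eta) *
   ((c_ sigma * lambda * A * \sum_(j < J) a j `^ qexp sigma) / (16 * N%:R)).
  by move: (\sum_(j < J) _) => s; field; rewrite ?gt_eqF.
by rewrite -[leLHS]mulr1 ler_pM2l// ler_pdivlMr// mul1r.
Qed.

(** Continuity of the measure from below: the condition with threshold [h] is the increasing union
    of those with thresholds [h + 1 / (k + 1)]. *)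
Let bad_set_cvg b h E : 0 < b ->
  (forall eta, 0 < eta -> (lebesgue_rV (bad_set b (h + eta)) <= E)%E) ->
  (lebesgue_rV (bad_set b h) <= E)%E.
Proof.
move=> b0 leE.
pose F (k : nat) : set (lebesgue_rV_type R N) := bad_set b (h + k.+1%:R^-1).
have FE : \bigcup_k F k = bad_set b h.
  apply/seteqP; split => [y [k _ [yb hy]]|y [yb hy]].
    by split => //; apply: lt_trans hy; rewrite ltrDl invr_gt0.
  have [k hk] : exists k : nat, k.+1%:R^-1 < - second_diff u x0 y - h.
    exists (Num.truncn (- second_diff u x0 y - h)^-1).
    rewrite invf_plt ?posrE ?subr_gt0//; exact: truncnS_gt.
  by exists k => //; split => //; rewrite addrC -ltrBrDr.
have mF k : measurable (F k) by exact: measurable_bad_set.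
have ndF : nondecreasing_seq F.
  move=> k l kl; apply/subsetPset => y [yb hy]; split => //; apply: le_lt_trans hy.
  by rewrite lerD2l lef_pV2 ?posrE// ler_nat ltnS.
have mUF : measurable (\bigcup_k F k) by exact: bigcupT_measurable.
have cvgF := nondecreasing_cvg_mu (mu := @lebesgue_rV R N) mF mUF ndF.
rewrite -FE -(cvg_lim _ cvgF)//; apply: lime_le; first by apply/cvg_ex; eexists; exact: cvgF.
by apply: nearW => k; apply: leE; rewrite invr_gt0.
Qed.

(** If every scale failed, each would already fail for some positive [eta]; as there are finitely
    many scales, the smallest of these contradicts [good_scale_eps]. *)
Lemma good_scale : exists j : 'I_J,
  (lebesgue_rV (bad_set (a j) (A * f x0 * a j ^+ 2)) <=
    (bad_frac n * box_volume sigma (a j))%:E)%E.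
Proof.
apply: contrapT => /forallNP noj.
have {}noj (j : 'I_J) : exists eta, 0 < eta /\
    ~ (lebesgue_rV (bad_set (a j) (A * (f x0 + eta) * a j ^+ 2)) <=
       (bad_frac n * box_volume sigma (a j))%:E)%E.
  apply: contrapT => /forallNP noeta; apply: (noj j).
  apply: bad_set_cvg => // eta eta0.
  have w0 : 0 < A * a j ^+ 2 by rewrite mulr_gt0 ?exprn_gt0.
  have := noeta (eta / (A * a j ^+ 2)); rewrite not_andE => -[|/contrapT].
    by rewrite divr_gt0.
  rewrite (_ : _ * a j ^+ 2 = A * f x0 * a j ^+ 2 + eta)//.
  by field; rewrite !gt_eqF.
have [eta etaP] := choice noj.
have [J0|J0] := posnP J.
  have [j _] := good_scale_eps ltr01.
  by have := ltn_ord j; rewrite [X in (_ < X)%N]J0.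
pose eta_min := \big[Num.min/1]_(j < J) eta j.
have eta_min0 : 0 < eta_min.
  by apply/bigmin_gtP; split => // j _; have [] := etaP j.
have [j] := good_scale_eps eta_min0.
have [_ nle] := etaP j; move=> /ltW lt; apply: nle; apply: le_trans lt.
apply: le_lebesgue_rV => y [yb hy]; split => //; apply: le_lt_trans hy.
rewrite ler_pM2r ?exprn_gt0// ler_pM2l// lerD2l; exact: bigmin_le.
Qed.

End good_scale.

(** * Flatness of the envelope at a good scale *)

Lemma obox0P (R : realType) n (w z : 'rV[R]_n) :
  obox 0 w z <-> forall i, `|z ord0 i| < w ord0 i.
Proof. by split=> zw i; have := zw i; rewrite [(0 : 'rV__) _ _]mxE subr0. Qed.

Section flatness.
Context {R : realType} {n : nat}.
Local Notation N := n.+1.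
Variables (sigma : 'I_N -> R) (u : 'rV[R]_N -> R).
Hypothesis sigma_bnd : forall i, 0 < sigma i < 2.
Hypothesis u_neg : forall x, ~ eball 0 1 x -> u x <= 0.
Hypothesis u_usc : upper_semicontinuous_on (closure (eball 0 1)) u.
Local Notation Gamma := (concave_envelope u).
Variable x0 : 'rV[R]_N.
Hypothesis x0_contact : contact_set u Gamma x0.
Variable b0 : 'rV[R]_N.
Hypothesis b0_super : superdifferential Gamma x0 b0.
Variables (a h : R).
Hypothesis a_gt0 : 0 < a.
Hypothesis width_le : forall i, awidth sigma a ord0 i <= N%:R^-1.
Hypothesis bad_le :
  (lebesgue_rV (bad_set sigma u x0 a h) <= (bad_frac n * box_volume sigma a)%:E)%E.

Local Notation l := (awidth sigma a).

Let x0G : u x0 = Gamma x0. Proof. by case: x0_contact. Qed.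

Let in_ball3 (y : 'rV[R]_N) : (forall i, `|y ord0 i| <= l ord0 i) -> eball 0 3 (x0 + y).
Proof.
move=> yl; apply/eball0P; apply: le_lt_trans (ler_enormD _ _) _.
have [/eball0P x01 _] := x0_contact.
have : enorm y <= N%:R * N%:R^-1.
  by apply: enorm_le_coord => // i; exact: le_trans (yl i) (width_le i).
rewrite mulfV// => y1; lra.
Qed.

Let good_lower z : obox 0 l z -> ~ bad_set sigma u x0 a h z ->
  u x0 + dot b0 z - h <= u (x0 + z).
Proof.
move=> zl zbad.
have zl' i : `|z ord0 i| <= l ord0 i by move/obox0P : zl => /(_ i)/ltW.
have sd : - second_diff u x0 z <= h.
  by rewrite leNgt; apply/negP => hz; exact: zbad.
have : eball 0 3 (x0 + - z) by apply: in_ball3 => i; rewrite mxE normrN.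
move=> /(superdifferential_contact u_neg u_usc x0_contact b0_super).
rewrite addrAC subrr add0r dotNr; move: sd; rewrite /second_diff; lra.
Qed.

(* If z and 2y - z are both good, then so is y by concavity; such a z exists
   because the bad set and its reflection cannot cover the half box around y. *)
Lemma envelope_flat (y : 'rV[R]_N) : (forall i, `|y ord0 i| <= 2^-1 * l ord0 i) ->
  Gamma x0 + dot b0 y - h <= Gamma (x0 + y).
Proof.
move=> yl.
pose Z := obox y (2^-1 *: l).
have Zbox z : Z z -> obox 0 l z.
  move=> Zz; apply/obox0P => i; have := Zz i; have := yl i.
  rewrite [(2^-1 *: l) _ _]mxE => h1 h2.
  rewrite -[z ord0 i](subrK (y ord0 i)); apply: le_lt_trans (ler_normD _ _) _; lra.
have Zrefl z : Z z -> Z (pointrefl (y + y) z).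
  move=> Zz i; rewrite (_ : _ - _ = - (z ord0 i - y ord0 i)).
    by rewrite normrN; exact: Zz.
  by rewrite /pointrefl !mxE; ring.
have [z Zz [zg rzg]] : exists2 z, Z z & ~ bad_set sigma u x0 a h z /\
    ~ bad_set sigma u x0 a h (pointrefl (y + y) z).
  apply: contrapT => noz.
  have cover : Z `<=` bad_set sigma u x0 a h `|`
      pointrefl (y + y) @^-1` bad_set sigma u x0 a h.
    move=> z Zz; apply: contrapT => /not_orP[zb rzb].
    by apply: noz; exists z.
  have := le_trans (le_lebesgue_rV cover) (lebesgue_rVU _ _).
  rewrite lebesgue_rV_refl lebesgue_rV_awidth//.
  move=> /le_trans/(_ (leeD bad_le bad_le)); rewrite -EFinD lee_fin.
  (* The half-size box has the share [2^-N] of the full volume, while the bad set and its reflection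
     together have at most half of that. *)
  apply/negP; rewrite -ltNge -mulrDl ltr_pM2r ?box_volume_gt0//.
  rewrite /bad_frac exprVn invfM.
  have : 0 < (2 ^+ N)^-1 :> R by rewrite invr_gt0 exprn_gt0.
  by move: ((2 ^+ N)^-1) => t; lra.
have h1 := good_lower (Zbox _ Zz) zg.
have h2 := good_lower (Zbox _ (Zrefl _ Zz)) rzg.
have b3 w : obox 0 l w -> eball 0 3 (x0 + w).
  by move=> /obox0P wl; apply: in_ball3 => i; exact: ltW.
have y3 : eball 0 3 (x0 + y).
  apply: in_ball3 => i; apply: le_trans (yl i) _.
  have := awidth_ge0 sigma a i; lra.
have z3 := b3 _ (Zbox _ Zz); have rz3 := b3 _ (Zbox _ (Zrefl _ Zz)).
have := envelope_midpoint u_neg u_usc y3 z3 rz3.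
rewrite /pointrefl => /(_ _); rewrite addrACA (addrC z) subrK addrACA => /(_ erefl).
have := le_u_envelope u_neg u_usc z3; have := le_u_envelope u_neg u_usc rz3.
move: h1 h2; rewrite /pointrefl dotBr dotDr x0G; lra.
Qed.

(** From [z] in the quarter box, a step of a quarter width along an axis stays in the half box.
    There [Gamma] is at least the plane at [x0] minus [h], and it is at most the plane of slope [p]
    at [z]; comparing them over the step bounds the difference of slopes. *)
Lemma superdifferential_box (z p : 'rV[R]_N) :
  (forall i, `|z ord0 i - x0 ord0 i| <= 4^-1 * l ord0 i) ->
  superdifferential Gamma z p -> forall i, `|p ord0 i - b0 ord0 i| * l ord0 i <= 4 * h.
Proof.
move=> zl [z3 pP] i.
have key (s : R) : `|s| = 1 -> s * (b0 ord0 i - p ord0 i) * l ord0 i <= 4 * h.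
  move=> s1.
  pose v : 'rV[R]_N := (s * (4^-1 * l ord0 i)) *: delta_mx ord0 i.
  have vz : forall j, `|(z - x0 + v) ord0 j| <= 2^-1 * l ord0 j.
    move=> j; rewrite mxE; apply: le_trans (ler_normD _ _) _.
    have := zl j; rewrite [(z - x0) _ _]mxE [(- x0) _ _]mxE => zj.
    have : `|v ord0 j| <= 4^-1 * l ord0 j.
      have -> : v ord0 j = s * (4^-1 * l ord0 i) * (j == i)%:R.
        by rewrite /v mxE [delta_mx _ _ _ _]mxE eqxx.
      case: eqP => [->|_]; last first.
        by rewrite mulr0 normr0 mulr_ge0// awidth_ge0.
      by rewrite mulr1 !normrM s1 mul1r !ger0_norm// awidth_ge0.
    lra.
  have zv : z + v = x0 + (z - x0 + v) by rewrite [RHS]addrA (addrC x0) subrK.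
  have := envelope_flat vz; rewrite -zv.
  have zv3 : eball 0 3 (z + v).
    rewrite zv; apply: in_ball3 => j; apply: le_trans (vz j) _; have := awidth_ge0 sigma a j; lra.
  have := pP _ zv3; rewrite (addrC z) addrK.
  have := b0_super.2 _ z3.
  rewrite !dotDr !dotZr !dot_delta; lra.
have := key 1 (normr1 _); have := key (-1); rewrite normrN1 => /(_ erefl).
rewrite mulN1r mul1r => h1 h2.
have l0 := awidth_ge0 sigma a i.
by case: (ger0P (p ord0 i - b0 ord0 i)) => hs; lra.
Qed.

(** A good displacement [x0 - y] controls [u] at [y], because the second difference sees
    [x0 + (x0 - y)] and [x0 - (x0 - y) = y] together. The set in question is bounded below in outer
    measure through the reflected good displacements. *)
Lemma lebesgue_rV_good_set :
  ((2^-1 * box_volume sigma a)%:E <=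
   lebesgue_rV [set y | obox x0 l y /\ (Gamma y - h <= u y)%R])%E.
Proof.
pose bad := bad_set sigma u x0 a h.
apply: (@le_trans _ _ (lebesgue_rV (pointrefl x0 @^-1` (obox 0 l `\` bad)))).
  rewrite lebesgue_rV_refl.
  have : (lebesgue_rV (obox 0 l) <= lebesgue_rV (obox 0 l `\` bad) + lebesgue_rV bad)%E.
    apply: le_trans (lebesgue_rVU _ _); apply: le_lebesgue_rV => y yl.
    by have [?|?] := pselect (bad y); [right|left].
  move=> /le_trans/(_ (leeD2l _ bad_le)).
  rewrite -leeBlDr// -[X in obox 0 X]scale1r lebesgue_rV_awidth// expr1n mul1r -EFinB.
  apply: le_trans; rewrite lee_fin -[X in _ <= X - _]mul1r -mulrBl.
  rewrite ler_pM2r ?box_volume_gt0//.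
  have : bad_frac n <= 2^-1 :> R.
    rewrite /bad_frac lef_pV2 ?posrE ?mulr_gt0 ?exprn_gt0//.
    have : 1 <= 2 ^+ N :> R by rewrite exprn_ege1// ler1n.
    lra.
  lra.
apply: le_lebesgue_rV => y /= [yl yg].
have yx i : `|y ord0 i - x0 ord0 i| < l ord0 i.
  by move/obox0P : yl => /(_ i); rewrite [(x0 - y) _ _]mxE [(- y) _ _]mxE distrC.
split=> //.
have y3 : eball 0 3 y.
  rewrite -(subrK x0 y) addrC; apply: in_ball3 => i.
  by rewrite [(y - x0) _ _]mxE [(- x0) _ _]mxE; exact/ltW.
have sd : - second_diff u x0 (pointrefl x0 y) <= h.
  by rewrite leNgt; apply/negP => hz; exact: yg.
have xy3 : eball 0 3 (x0 + (x0 - y)).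
  by apply: in_ball3 => i; rewrite [(x0 - y) _ _]mxE [(- y) _ _]mxE distrC; exact/ltW.
have := superdifferential_contact u_neg u_usc x0_contact b0_super xy3.
have := b0_super.2 _ y3.
move: sd; rewrite /second_diff /pointrefl.
rewrite (_ : x0 - (x0 - y) = y); last by rewrite opprB addrC subrK.
rewrite (_ : x0 + (x0 - y) - x0 = - (y - x0)); last by rewrite addrAC subrr add0r opprB.
by rewrite dotNr x0G; lra.
Qed.

End flatness.

(* Chosen so that the half-sides of the first box are at most 1/N, which keeps it
   in the unit ball. *)
Definition rho0 {R : realType} (n : nat) : R := (4 * n.+1%:R)^-1 ^+ (n.+1 + 2).

(** * The largest scale and the lower bound for the sum over scales *)

Section initial_scale.
Context {R : realType} {n : nat}.
Local Notation N := n.+1.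
Variable sigma : 'I_N -> R.
Hypothesis sigma_bnd : forall i, 0 < sigma i < 2.

Lemma awidth_mono a b i : 0 <= a <= b -> awidth sigma a ord0 i <= awidth sigma b ord0 i.
Proof.
move=> /andP[a0 ab]; rewrite !mxE ge0_ler_powR ?nnegrE//.
- by rewrite ltW// aexp_gt0.
- exact: le_trans ab.
Qed.

Lemma rho0_gt0 : 0 < rho0 n :> R.
Proof. by rewrite exprn_gt0// invr_gt0 mulr_gt0. Qed.

Lemma rho0_le1 : rho0 n <= 1 :> R.
Proof.
rewrite exprn_ile1// ?invr_ge0 ?mulr_ge0// invf_le1 ?mulr_gt0//.
have : 1 <= N%:R :> R by rewrite ler1n.
lra.
Qed.

Definition size0 : R := rho0 n * 2 `^ (- (1 / q_max sigma)).

(** Half-side of the largest cubes. The division by 2 is there because diameters are measured by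
    full sides. *)
Definition half0 : R := size0 `^ (1 / pmin sigma) / 2.

Lemma size0_gt0 : 0 < size0.
Proof. by rewrite mulr_gt0 ?rho0_gt0 ?powR_gt0. Qed.

Lemma size0_le : size0 <= rho0 n.
Proof.
rewrite /size0 ger_pMr ?rho0_gt0// powRN invf_le1 ?powR_gt0//.
rewrite -[leLHS](powRr0 2) ler_powR ?ler1n//.
by rewrite divr_ge0// ltW// qmax_gt0.
Qed.

Lemma half0_gt0 : 0 < half0.
Proof. by rewrite divr_gt0// powR_gt0// size0_gt0. Qed.

Lemma double_half0_le i : 2 * half0 <= size0 `^ (1 / (N%:R + sigma i)).
Proof.
rewrite /half0 mulrC divfK//; apply: ger_powR.
  by rewrite size0_gt0 (le_trans size0_le) ?rho0_le1.
by rewrite !div1r lef_pV2 ?posrE ?pmin_gt0 ?exponent_gt0// pmin_le.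
Qed.

(** [rho0] is the power [N + 2] of [(4 * N)^-1] and lies below 1, so a root of order at most [N + 2]
    is no larger than [(4 * N)^-1]. *)
Let size0_root (e : R) : 0 < e <= N%:R + 2 -> size0 `^ (1 / e) <= (4 * N%:R)^-1.
Proof.
move=> /andP[e0 eN].
have b0 : 0 <= (4 * N%:R)^-1 :> R by rewrite invr_ge0 mulr_ge0.
have b1 : (4 * N%:R)^-1 <= 1 :> R.
  rewrite invf_le1 ?mulr_gt0//; have : 1 <= N%:R :> R by rewrite ler1n.
  lra.
apply: (@le_trans _ _ (rho0 n `^ (1 / e))).
  by rewrite ge0_ler_powR ?nnegrE ?divr_ge0// ?size0_le// ltW// ?size0_gt0 ?rho0_gt0.
rewrite /rho0 -powR_mulrn// -powRrM natrD.
have -> : (4 * N%:R)^-1 = ((4 * N%:R)^-1) `^ 1 :> R by rewrite powRr1.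
rewrite [X in X `^ _ <= _]powRr1//; apply: ger_powR; first by rewrite b1 andbT invr_gt0 mulr_gt0.
by rewrite mulrA mulr1 ler_pdivlMr// mul1r.
Qed.

Lemma scale0_le1 : 8 * half0 <= 1.
Proof.
rewrite /half0; have := size0_root (e := pmin sigma).
rewrite pmin_gt0// (ltW (pmin_lt _))// => /(_ isT).
have : (4 * N%:R)^-1 <= 4^-1 :> R.
  by rewrite lef_pV2 ?posrE ?mulr_gt0// ler_peMr// ler1n.
by move: (size0 `^ _) ((4 * N%:R)^-1) => x y; lra.
Qed.

Lemma awidth_scale0 i : awidth sigma (8 * half0) ord0 i <= N%:R^-1.
Proof.
have p0 := pmin_gt0 sigma_bnd.
have -> : 8 * half0 = 4 * size0 `^ (1 / pmin sigma) by rewrite /half0; field.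
rewrite mxE powRM ?powR_ge0// -powRrM.
have -> : 1 / pmin sigma * aexp sigma i = 1 / (N%:R + sigma i).
  have := exponent_gt0 sigma_bnd i; rewrite /aexp.
  by move: (pmin sigma) (N%:R + sigma i) p0 => p e p1 e1; field; rewrite !gt_eqF.
have := size0_root (e := N%:R + sigma i).
rewrite exponent_gt0// (ltW (exponent_ltN2 _ _))// => /(_ isT) h.
apply: (@le_trans _ _ (4 * (4 * N%:R)^-1)).
  apply: ler_pM; rewrite ?powR_ge0//.
  by rewrite ler1_powR ?ler1n// aexp_le1.
by rewrite invfM mulrA divff// mul1r.
Qed.

(** The terms decay geometrically with ratio [2^-qexp], so about [1 / qexp] of them stay comparable
    to the first; their number compensates the factor [c_ sigma], which is at least
    [qexp / (3 * (N + 2))]. *)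
Lemma sum_scales_ge : exists J : nat, rho0 n ^+ 2 / (12 * (N%:R + 2)) <=
  c_ sigma * \sum_(j < J) (8 * half0 / 2 ^+ j) `^ qexp sigma.
Proof.
have p0 := pmin_gt0 sigma_bnd.
have Q0 := qexp_gt0 sigma_bnd.
have h0 := half0_gt0.
pose J := Num.truncn (1 / qexp sigma); exists J.+1.
(* Here the form of [size0] matters: its power [q_max] is the power [q_max] of [rho0] divided by 2,
   and [q_max <= 2]. *)
have base : rho0 n ^+ 2 / 2 <= (8 * half0) `^ qexp sigma.
  have -> : 8 * half0 = 4 * size0 `^ (1 / pmin sigma) by rewrite /half0; field.
  rewrite (powRM _ (ler0n _ 4) (powR_ge0 _ _)) -powRrM.
  have : 1 <= 4 `^ qexp sigma by rewrite -[leLHS](powRr0 4) ler_powR ?ler1n// ltW.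
  have : rho0 n ^+ 2 / 2 <= size0 `^ (1 / pmin sigma * qexp sigma).
    apply: (@le_trans _ _ (size0 `^ q_max sigma)); last first.
      apply: ger_powR; first by rewrite size0_gt0 (le_trans size0_le) ?rho0_le1.
      by rewrite mulrC mulrA mulr1 ler_pdivrMr// mulrC qexp_le_qmax.
    have qm0 := qmax_gt0 sigma_bnd.
    rewrite /size0 powRM ?powR_ge0 ?(ltW rho0_gt0)// -powRrM mulNr div1r mulVf ?gt_eqF//.
    rewrite powR_inv1// ler_pM2r ?invr_gt0//.
    rewrite -powR_mulrn ?(ltW rho0_gt0)//; apply: ger_powR; last exact: qmax_le2.
    by rewrite rho0_gt0 rho0_le1.
  have := powR_ge0 size0 (1 / pmin sigma * qexp sigma).
  by move: (4 `^ _) (size0 `^ _) => x y; nra.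
(* For [j] up to the truncation of [1 / qexp], the factor lost against the first term is at most
   2. *)
have term j : (j < J.+1)%N ->
    rho0 n ^+ 2 / 4 <= (8 * half0 / 2 ^+ j) `^ qexp sigma.
  rewrite ltnS => jJ.
  have jQ : j%:R * qexp sigma <= 1.
    rewrite -ler_pdivlMr//; apply: (@le_trans _ _ J%:R).
      by rewrite ler_nat.
    by rewrite /J truncn_le divr_ge0// ltW.
  have h8 : 0 <= 8 * half0 by rewrite ltW// mulr_gt0.
  have j0 : 0 <= (2 ^+ j)^-1 :> R by rewrite invr_ge0 exprn_ge0.
  rewrite (powRM _ h8 j0).
  have -> : (2 ^+ j)^-1 `^ qexp sigma = (2 `^ (j%:R * qexp sigma))^-1 :> R.
    have e0 : 0 <= 2 ^+ j :> R by rewrite exprn_ge0.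
    by rewrite powRrM powR_mulrn// -(powR_inv1 e0) powRAC powR_inv1 ?powR_ge0.
  have : 2^-1 <= (2 `^ (j%:R * qexp sigma))^-1 :> R.
    by rewrite lef_pV2 ?posrE ?powR_gt0// ler1_powR ?ler1n.
  rewrite (_ : _ / 4 = rho0 n ^+ 2 / 2 * 2^-1); last by field.
  by apply: ler_pM; rewrite ?invr_ge0 ?divr_ge0 ?sqr_ge0.
have JQ : 1 <= J.+1%:R * qexp sigma.
  by rewrite -ler_pdivrMr// ltW// truncnS_gt.
apply: (@le_trans _ _ (c_ sigma * (J.+1%:R * (rho0 n ^+ 2 / 4)))); last first.
  rewrite (ler_pM2l (c_sigma_gt0 sigma_bnd)).
  apply: (@le_trans _ _ (\sum_(j < J.+1) (rho0 n ^+ 2 / 4))).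
    by rewrite sumr_const card_ord -[leRHS]mulr_natl.
  by apply: ler_sum => j _; exact: term.
have Qc := qexp_le_c_sigma sigma_bnd.
have M0 : 0 < N%:R + 2 :> R by rewrite ltr_wpDl.
have : 1 <= c_ sigma * J.+1%:R * (3 * (N%:R + 2)).
  apply: (le_trans JQ); rewrite mulrC.
  apply: (@le_trans _ _ (3 * (N%:R + 2) * c_ sigma * J.+1%:R)); last by rewrite -mulrA mulrC.
  by rewrite ler_wpM2r.
rewrite ler_pdivrMr ?mulr_gt0//.
have : 0 <= rho0 n ^+ 2 :> R by rewrite sqr_ge0.
move: (rho0 n ^+ 2) (c_ sigma) (J.+1%:R) (N%:R + 2) => r c j M r0 h.
have := ler_wpM2l r0 h; lra.
Qed.

End initial_scale.

(** * Closures and diameters of boxes *)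

Section box_closure_diameter.
Context {R : realType} {n : nat}.
Implicit Types c w : 'rV[R]_n.

Lemma closure_obox_sub c w : closure (obox c w) `<=` cbox c w.
Proof.
move=> y cly i; apply/ler_addgt0Pr => e e0.
have [z [zc]] := cly _ (nbhsx_ballx y _ e0).
rewrite -ball_normE /= => zy.
have := le_lt_trans (coord_le_norm (y - z) i) zy.
rewrite !mxE => yz; have := zc i.
rewrite -[y ord0 i](subrK (z ord0 i)) -addrA => zi.
by apply: le_trans (ler_normD _ _) _; lra.
Qed.

(** A point of the closed box moved slightly towards the centre lies in the open box; [t] is chosen
    so that the move is shorter than [e]. *)
Lemma cbox_sub_closure c w : (forall i, 0 < w ord0 i) -> cbox c w `<=` closure (obox c w).
Proof.
move=> w0 y yc B /nbhs_ballP[e /= e0 eB].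
pose d := `|y - c| + 1.
have d0 : 0 < d by rewrite ltr_wpDl.
pose t := Num.min 1 (e / d).
have t0 : 0 < t by rewrite lt_min ltr01 divr_gt0.
have t1 : t <= 1 by rewrite ge_min lexx.
exists (c + (1 - t) *: (y - c)); split.
  move=> i; rewrite !mxE addrAC subrr add0r.
  have := yc i; have := w0 i; move: (w ord0 i) => wi wi0 yi.
  rewrite normrM ger0_norm ?subr_ge0//.
  have : t * `|y ord0 i - c ord0 i| >= 0 by rewrite mulr_ge0// ltW.
  have : (1 - t) * `|y ord0 i - c ord0 i| <= (1 - t) * wi.
    by rewrite ler_wpM2l// subr_ge0.
  have : 0 < t * wi by rewrite mulr_gt0.
  lra.
apply: eB; rewrite -ball_normE /=.
rewrite (_ : y - (c + (1 - t) *: (y - c)) = t *: (y - c)); last first.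
  by apply/rowP => i; rewrite !mxE; ring.
rewrite normrZ gtr0_norm//; apply: (@le_lt_trans _ _ (e / d * `|y - c|)).
  by rewrite ler_wpM2r// ge_min lexx orbT.
by rewrite mulrAC ltr_pdivrMr// ltr_pM2l// ltrDl.
Qed.

Let dist_obox c w p : (obox c w `*` obox c w) p -> (forall i, 0 <= w ord0 i) ->
  enorm (p.1 - p.2) <= Num.sqrt (\sum_i (2 * w ord0 i) ^+ 2).
Proof.
move=> [p1 p2] w0; apply: ler_wsqrtr; apply: ler_sum => i _.
rewrite -real_normK ?num_real// ler_sqr ?nnegrE ?mulr_ge0//.
have := p1 i; have := p2 i; rewrite !mxE -(opprB (c ord0 i)) normrN => h1 h2.
rewrite (_ : _ - _ = (p.1 ord0 i - c ord0 i) + (c ord0 i - p.2 ord0 i)); last by ring.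
by apply: le_trans (ler_normD _ _) _; lra.
Qed.

Lemma diam_obox_le c w : (forall i, 0 < w ord0 i) ->
  diam (obox c w) <= Num.sqrt (\sum_i (2 * w ord0 i) ^+ 2).
Proof.
move=> w0; have cc : obox c w c by move=> i; rewrite subrr normr0.
apply: ge_sup; first by exists (enorm (c - c)), (c, c).
by move=> _ [p pc <-]; exact: (@dist_obox c w p pc (fun i => ltW (w0 i))).
Qed.

Lemma diam_obox_ge c w i : (forall j, 0 < w ord0 j) -> w ord0 i <= diam (obox c w).
Proof.
move=> w0; pose v : 'rV[R]_n := (2^-1 * w ord0 i) *: delta_mx ord0 i.
have vw j : `|v ord0 j| < w ord0 j.
  rewrite !mxE eqxx /=; case: eqP => [->|_]; last by rewrite mulr0 normr0.
  by rewrite mulr1 gtr0_norm ?mulr_gt0//; have := w0 i; lra.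
have sub : [set enorm (p.1 - p.2) | p in obox c w `*` obox c w] (w ord0 i).
  exists (c + v, c - v) => /=.
    split=> j /=; rewrite !mxE addrAC subrr add0r; have := vw j; rewrite !mxE//.
    by rewrite normrN.
  rewrite (_ : c + v - (c - v) = w ord0 i *: delta_mx ord0 i); last first.
    by apply/rowP => j; rewrite !mxE; field.
  apply/eqP; rewrite -(@eqrXn2 _ 2)//= ?enorm_ge0 ?(ltW (w0 i))//.
  by rewrite sqr_enorm dotZr dot_delta !mxE !eqxx mulr1.
apply: ub_le_sup sub; exists (Num.sqrt (\sum_i (2 * w ord0 i) ^+ 2)).
by move=> _ [p pc <-]; exact: (@dist_obox c w p pc (fun j => ltW (w0 j))).
Qed.

End box_closure_diameter.

Lemma le_sup_positive_part (R : realType) T (f : T -> R) (M : R) (A : set T) x :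
  (forall y, `|f y| <= M) -> A x ->
  Num.max (f x) 0 <= sup [set Num.max (f z) 0 | z in A].
Proof.
move=> f_bnd Ax; apply: ub_le_sup; last by exists x.
exists M => _ [z _ <-]; rewrite ge_max (le_trans (ler_norm _) (f_bnd z))/=.
exact: le_trans (normr_ge0 _) (f_bnd z).
Qed.

(** * Gradient and measure estimates on a good cube *)

Section good_cube.
Context {R : realType} {n : nat}.
Local Notation N := n.+1.
Variables (sigma : 'I_N -> R) (f u : 'rV[R]_N -> R).
Hypothesis sigma_bnd : forall i, 0 < sigma i < 2.
Hypothesis u_neg : forall x, ~ eball 0 1 x -> u x <= 0.
Hypothesis u_usc : upper_semicontinuous_on (closure (eball 0 1)) u.
Local Notation Gamma := (concave_envelope u).
Variables (M : R) (x0 c : 'rV[R]_N) (A C b : R).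
Hypothesis f_bnd : forall x, `|f x| <= M.
Hypothesis x0_contact : contact_set u Gamma x0.
Hypothesis fx0 : 0 <= f x0.
Hypothesis A_gt0 : 0 < A.
Hypothesis b_gt0 : 0 < b.
Hypothesis b_le1 : 8 * b <= 1.
Hypothesis width_le : forall i, awidth sigma (8 * b) ord0 i <= N%:R^-1.
Local Notation B := (obox c (const_mx b)).
Local Notation Bt := (obox c (awidth sigma b)).
Hypothesis x0_cube : closure B x0.
Local Notation h := (A * f x0 * (8 * b) ^+ 2).
Hypothesis bad_le :
  (lebesgue_rV (bad_set sigma u x0 (8 * b) h) <=
   (bad_frac n * box_volume sigma (8 * b))%:E)%E.

Let b8_gt0 : 0 < 8 * b. Proof. by rewrite mulr_gt0. Qed.

Let le_sup_f : f x0 <= sup [set f z | z in closure B].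
Proof.
apply: ub_le_sup; last by exists x0.
exists M => _ [z _ <-]; exact: le_trans (ler_norm _) (f_bnd z).
Qed.

Let x0_c i : `|x0 ord0 i - c ord0 i| <= b.
Proof. by have := closure_obox_sub x0_cube i; rewrite [const_mx _ _ _]mxE. Qed.

(** Flatness is used at the scale [8 * b]: two points of the closed cube differ by at most [2 * b]
    in each coordinate, a quarter of the smallest width at that scale, so all supergradients over
    the cube are near one at [x0]. *)
Lemma good_cube_gradient :
  (lebesgue_rV (grad_image Gamma (closure B)) <=
   ((32 * A) ^+ N * sup [set Num.max (f z) 0 | z in closure B] ^+ N)%:E *
   lebesgue_rV (closure B))%E.
Proof.
have [b0 b0P] := superdifferential_neq0 u_neg u_usc x0_contact.1.
(* This is [4 * h / (8 * b)], every width being at least [8 * b]; doubled, it is [32 * A * f x0]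
   times the side [2 * b]. *)
pose w := 4 * A * f x0 * (8 * b).
have w0 : 0 <= w by rewrite !mulr_ge0// ltW.
have sub : grad_image Gamma (closure B) `<=` cbox b0 (const_mx w).
  move=> p [z zB zp] i; rewrite mxE.
  have l8 j : 8 * b <= awidth sigma (8 * b) ord0 j by rewrite le_awidth// b8_gt0.
  have zx j : `|z ord0 j - x0 ord0 j| <= 4^-1 * awidth sigma (8 * b) ord0 j.
    have := closure_obox_sub zB j; rewrite [const_mx _ _ _]mxE => zc.
    have := x0_c j; have := l8 j; move: zc.
    rewrite (_ : z ord0 j - x0 ord0 j =
      (z ord0 j - c ord0 j) - (x0 ord0 j - c ord0 j)); last by ring.
    move=> h1 h2 h3; apply: le_trans (ler_normB _ _) _; lra.
  have := superdifferential_box u_neg u_usc x0_contact b0P b8_gt0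
    width_le bad_le zx zp i.
  move=> hp; rewrite -(ler_pM2r b8_gt0).
  apply: (@le_trans _ _ (`|p ord0 i - b0 ord0 i| * awidth sigma (8 * b) ord0 i)).
    by rewrite ler_wpM2l.
  by apply: le_trans hp _; rewrite /w; lra.
apply: (le_trans (le_lebesgue_rV sub)).
rewrite lebesgue_rV_cbox => [|i]; last by rewrite mxE.
rewrite prod_cube; set F := sup _.
have fF : Num.max (f x0) 0 <= F := le_sup_positive_part f_bnd x0_cube.
have [le_sup_fpos F0] : f x0 <= F /\ 0 <= F by move: fF; rewrite ge_max => /andP.
apply: (@le_trans _ _ (((32 * A) ^+ N * F ^+ N)%:E * lebesgue_rV B)%E); last first.
  apply: lee_wpmul2l; last by apply: le_lebesgue_rV; exact: subset_closure.
  by rewrite lee_fin mulr_ge0 ?exprn_ge0// mulr_ge0// ltW.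
rewrite lebesgue_rV_obox => [|i]; last by rewrite mxE ltW.
have w2 : 0 <= 2 * w by rewrite mulr_ge0.
have F2 : 0 <= 32 * A * F * (2 * b) by rewrite !mulr_ge0// ltW.
have wF : 2 * w <= 32 * A * F * (2 * b).
  have : A * b * f x0 <= A * b * F by rewrite ler_wpM2l// mulr_ge0// ltW.
  rewrite /w; lra.
by rewrite prod_cube -EFinM lee_fin -!exprMn lerXn2r ?nnegrE.
Qed.

(** The widths at scale [8 * b] are at most 8 times those at [b], and [x0] is within one width of
    [c]: hence 9. The deviation [h] is [64 * A * f x0 * b ^+ 2], and [b] is at most the diameter. *)
Lemma good_cube_measure : 9 <= C -> 64 * A <= C ->
  ((2^-1)%:E * lebesgue_rV Bt <=
   lebesgue_rV [set y | dilate C c Bt y /\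
     (Gamma y - C * sup [set f z | z in closure B] * diam Bt ^+ 2 <= u y)%R])%E.
Proof.
move=> C9 CA.
have C0 : 0 < C by lra.
have [b0 b0P] := superdifferential_neq0 u_neg u_usc x0_contact.1.
have b1 : b <= 1 by have := b_gt0; move: b_le1; lra.
have lb i : b <= awidth sigma b ord0 i by apply: le_awidth => //; rewrite b_gt0.
have l8 i : awidth sigma (8 * b) ord0 i <= 8 * awidth sigma b ord0 i.
  rewrite !mxE (powRM _ (ler0n _ 8) (ltW b_gt0)) ler_wpM2r ?powR_ge0//.
  by rewrite ler1_powR ?ler1n// aexp_le1.
apply: (@le_trans _ _ (2^-1 * box_volume sigma (8 * b))%:E).
  have := @lebesgue_rV_awidth R n sigma c b 1 b_gt0 ler01.
  rewrite scale1r expr1n mul1r => ->; rewrite -EFinM lee_fin ler_wpM2l//.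
  rewrite ler_wpM2l ?exprn_ge0// ge0_ler_powR ?nnegrE ?(ltW b_gt0) ?(ltW b8_gt0)//.
    by rewrite sumr_ge0// => i _; rewrite ltW// aexp_gt0.
  by rewrite ler_peMl ?(ltW b_gt0)// ler1n.
have G := lebesgue_rV_good_set u_neg u_usc x0_contact b0P b8_gt0 width_le bad_le.
apply: le_trans G _.
apply: le_lebesgue_rV => y /= [yl yu]; split.
  exists (c + C^-1 *: (y - c)).
    move=> i; rewrite !mxE addrAC subrr add0r normrM gtr0_norm ?invr_gt0//.
    rewrite mulrC ltr_pdivrMr//.
    have := yl i; have := x0_c i; have := l8 i; have := lb i.
    have : 9 * awidth sigma b ord0 i <= C * awidth sigma b ord0 i.
      by rewrite ler_wpM2r// awidth_ge0.
    rewrite (_ : y ord0 i - c ord0 i =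
      (y ord0 i - x0 ord0 i) + (x0 ord0 i - c ord0 i)); last by ring.
    rewrite [b `^ _](_ : _ = awidth sigma b ord0 i); last by rewrite mxE.
    move=> h1 h2 h3 h4 h5; apply: le_lt_trans (ler_normD _ _) _; lra.
  by rewrite addrAC subrr add0r scalerA divff ?gt_eqF// scale1r addrC subrK.
apply: le_trans yu; rewrite lerD2l lerN2.
set F := sup _.
have fF : f x0 <= F := le_sup_f.
have F0 : 0 <= F by exact: le_trans fF.
have d0 : b <= diam Bt.
  apply: le_trans (lb ord0) (diam_obox_ge _ _ _) => i.
  exact: lt_le_trans (lb i).
have : A * f x0 * 64 * b ^+ 2 <= C * F * diam Bt ^+ 2.
  have fAF : A * f x0 * 64 <= C * F.
    rewrite mulrAC (mulrC A); apply: ler_pM => //.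
    by rewrite mulr_ge0// ltW.
  apply: ler_pM => //; first by rewrite !mulr_ge0// ltW.
    by rewrite sqr_ge0.
  by rewrite ler_sqr ?nnegrE ?(ltW b_gt0)// (le_trans (ltW b_gt0)).
by apply: le_trans; lra.
Qed.

End good_cube.

(** * Selection of the cubes *)

Section dyadic_selection.
Context {R : realType} {N : nat}.
Variables (b0 : R) (J : nat) (E : set 'rV[R]_N) (good : nat -> 'rV[R]_N -> Prop).
Hypothesis b0_gt0 : 0 < b0.
Hypothesis E_bnd : forall x, E x -> forall i, `|x ord0 i| <= 1.

Let half (j : nat) := b0 / 2 ^+ j.
Let cube (j : nat) (c : 'rV[R]_N) := obox c (const_mx (half j)).

Hypothesis E_good : forall x, E x ->
  exists2 j, (j < J)%N & forall c, closure (cube j c) x -> good j c.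

(** A cube is coded by its level and the integer position of its corner in a grid starting at [-2]
    on each axis. Coordinates of points of [E], shifted by 2, are at most 3, so [K] positions per
    axis suffice even at the finest level. *)
Let K := (Num.truncn (3 / (2 * half J))).+1.
Let T : finType := ('I_J * {ffun 'I_N -> 'I_K})%type.
Let center (t : T) : 'rV[R]_N := \row_i (- 2 + (2 * (t.2 i : nat)%:R + 1) * half t.1).
Let tcube (t : T) := cube t.1 (center t).
Let tgood (t : T) := good t.1 (center t).

Let half_gt0 j : 0 < half j. Proof. by rewrite divr_gt0 ?exprn_gt0. Qed.

Let tcubeP t y : tcube t y <-> forall i,
  (t.2 i : nat)%:R * (2 * half t.1) < y ord0 i + 2 < (t.2 i).+1%:R * (2 * half t.1).
Proof.
have E1 i : ((t.2 i : nat)%:R * (2 * half t.1) < y ord0 i + 2 <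
   (t.2 i).+1%:R * (2 * half t.1)) = (`|y ord0 i - center t ord0 i| < half t.1).
  rewrite !mxE ltr_distl -(natr1 (t.2 i)); move: ((t.2 i : nat)%:R) (half _) (y _ _) => k s z.
  by apply/andP/andP => -[h1 h2]; split; lra.
split=> yt i; first by rewrite E1; have := yt i; rewrite [const_mx _ _ _]mxE.
by rewrite [const_mx _ _ _]mxE -E1; exact: yt.
Qed.

(** A common point forces the corner indices to satisfy [k * 2 ^ d <= k' < (k + 1) * 2 ^ d], with
    [d] the difference of levels. This is inclusion, and equality when [d = 0]. *)
Let nested (t t' : T) (y : 'rV[R]_N) : (t.1 <= t'.1)%N -> tcube t y -> tcube t' y ->
  tcube t' `<=` tcube t /\ (t.1 = t'.1 -> t = t').
Proof.
move=> tt' /tcubeP yt /tcubeP yt'.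
pose d := (t'.1 - t.1)%N.
have td : (t'.1 : nat) = (t.1 + d)%N by rewrite subnKC.
have hd : 2 * half t.1 = (2 ^ d)%:R * (2 * half t'.1).
  rewrite /half td exprD natrX; field.
  by rewrite !expf_neq0.
have s0 : 0 < 2 * half t'.1 by rewrite mulr_gt0.
have lo i : (t.2 i * 2 ^ d <= t'.2 i)%N.
  have /andP[h1 _] := yt i; have /andP[_ h2] := yt' i.
  have := lt_trans h1 h2; rewrite hd mulrA -natrM ltr_pM2r// ltr_nat ltnS.
  by [].
have hi i : ((t'.2 i).+1 <= (t.2 i).+1 * 2 ^ d)%N.
  have /andP[_ h1] := yt i; have /andP[h2 _] := yt' i.
  have := lt_trans h2 h1; by rewrite hd [ltRHS]mulrA -natrM ltr_pM2r// ltr_nat.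
split=> [z /tcubeP zt'|e1].
  apply/tcubeP => i; have /andP[h1 h2] := zt' i; rewrite hd; apply/andP; split.
    by apply: le_lt_trans h1; rewrite mulrA -natrM ler_pM2r// ler_nat.
  by apply: (lt_le_trans h2); rewrite [leRHS]mulrA -natrM ler_pM2r// ler_nat.
have d0 : d = 0%N by rewrite /d e1 subnn.
have lo0 i : (t.2 i <= t'.2 i)%N by have := lo i; rewrite d0 expn0 muln1.
have hi0 i : (t'.2 i <= t.2 i)%N by have := hi i; rewrite d0 expn0 muln1 ltnS.
rewrite (surjective_pairing t) (surjective_pairing t') e1; congr (_, _).
by apply/ffunP => i; apply/val_inj/eqP => /=; rewrite eqn_leq lo0 hi0.
Qed.

(** Lower levels are larger cubes, so by nesting this is maximality among the good cubes, stated as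
    disjointness from every larger good one. *)
Let selected t := tgood t /\
  forall t', tgood t' -> (t'.1 < t.1)%N -> tcube t' `&` tcube t = set0.

(** The point lies in the closure of a good cube of its own level; among the good cubes containing
    that cube, one of least level is selected. *)
Let cover x : E x -> exists2 t, selected t & closure (tcube t) x.
Proof.
move=> Ex; have [j jJ goodj] := E_good Ex.
have s0 : 0 < 2 * half j by rewrite mulr_gt0.
have x2 i : 0 <= x ord0 i + 2 <= 3.
  by have := E_bnd Ex i; rewrite ler_norml => /andP[h1 h2]; apply/andP; split; lra.
pose k i := Num.truncn ((x ord0 i + 2) / (2 * half j)).
have kK i : (k i < K)%N.
  rewrite ltnS; apply: le_truncn; have /andP[h1 h2] := x2 i.
  apply: ler_pM => //; first by rewrite invr_ge0 ltW.
  rewrite lef_pV2 ?posrE ?mulr_gt0// ler_pM2l// ler_pM2l// lef_pV2 ?posrE ?exprn_gt0//.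
  by rewrite ler_eXn2l ?ltr1n// ltnW.
pose t : T := (Ordinal jJ, [ffun i => Ordinal (kK i)]).
have xt : closure (tcube t) x.
  apply: cbox_sub_closure => [i|i]; first by rewrite mxE.
  have /andP[h1 _] := x2 i.
  have := truncn_itv (divr_ge0 h1 (ltW s0)); rewrite -/(k i).
  rewrite ler_pdivlMr// ltr_pdivrMr// => /andP[h2 h3].
  rewrite !mxE ffunE /= ler_distl; move: h2 h3; rewrite -(natr1 (k i)).
  by move: ((k i)%:R) (half j) => a s h2 h3; apply/andP; split; lra.
have tt : tgood t by apply: goodj.
pose P (l : nat) := `[< exists t' : T, [/\ tgood t', tcube t `<=` tcube t' & (t'.1 : nat) = l] >].
have exP : exists l, P l by exists j; apply/asboolP; exists t; split.
case: (ex_minnP exP) => l /asboolP[t' [gt' tt' lt']] lmin.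
exists t'; last exact: (closure_subset tt').
split=> // t'' gt'' ltt; rewrite -subset0 => y [y1 y2].
have [sub _] := nested (ltnW ltt) y1 y2.
have : (l <= t''.1)%N.
  by apply: lmin; apply/asboolP; exists t''; split=> //; exact: subset_trans sub.
by rewrite -lt' leqNgt ltt.
Qed.

(* The family consists of the maximal good dyadic cubes. *)
Lemma dyadic_selection : exists (m : nat) (c : 'I_m -> 'rV[R]_N) (l : 'I_m -> nat),
  [/\ forall k, (l k < J)%N /\ good (l k) (c k),
      forall i j, i != j ->
        obox (c i) (const_mx (b0 / 2 ^+ l i)) `&` obox (c j) (const_mx (b0 / 2 ^+ l j)) = set0 &
      E `<=` \bigcup_k closure (obox (c k) (const_mx (b0 / 2 ^+ l k)))].
Proof.
pose S : {set T} := [set t | `[< selected t >]]%SET.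
pose pick (k : 'I_#|S|) : T := enum_val k.
exists #|S|, (center \o pick), (fun k => nat_of_ord (pick k).1).
have selS k : selected (pick k).
  by have := enum_valP k; rewrite inE => /asboolP.
split=> [k|i j ij|x Ex].
- by split; [exact: ltn_ord|have [] := selS k].
- have disj (t t' : T) : selected t -> selected t' -> t != t' ->
      (t.1 <= t'.1)%N -> tcube t `&` tcube t' = set0.
    move=> [gt _] [_ st'] tt'; rewrite leq_eqVlt => /orP[/eqP e1|]; last exact: st'.
    rewrite -subset0 => y [y1 y2].
    have [_ /(_ (val_inj e1)) tE] := nested (eq_leq e1) y1 y2.
    by rewrite tE eqxx in tt'.
  have ne : pick i != pick j by apply: contra_neq ij => /enum_val_inj.
  have [le|/ltnW le] := leqP (pick i).1 (pick j).1; first exact: disj.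
  by rewrite setIC; apply: disj => //; rewrite eq_sym.
- have [t st xt] := cover Ex.
  have tS : t \in S by rewrite inE; apply/asboolP.
  by exists (enum_rank_in tS t) => //=; rewrite /pick enum_rankK_in.
Qed.

End dyadic_selection.

Section cubes_as_boxes.
Context {R : realType} {n : nat}.
Local Notation N := n.+1.
Variable sigma : 'I_N -> R.
Hypothesis sigma_bnd : forall i, 0 < sigma i < 2.

(** With [r = 1] only the factor in [s] remains; it is the same in all directions and equals [b] for
    this choice of [s]. *)
Lemma Rbox_cube (b : R) (c : 'rV[R]_N) : 0 < b ->
  Rbox sigma 1 (b `^ pmin sigma) c = obox c (const_mx b).
Proof.
move=> b0; have p0 := pmin_gt0 sigma_bnd.
have E i : (b `^ pmin sigma) `^ (1 / (N%:R + sigma_min sigma)) *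
    1 `^ (1 / (N%:R + sigma i)) = (const_mx b : 'rV[R]_N) ord0 i.
  by rewrite mxE powR1 mulr1 -powRrM mulrA mulr1 divff ?gt_eqF// powRr1// ltW.
by apply/seteqP; split => y yc i; have := yc i; rewrite E.
Qed.

Lemma Rbox_tilde_cube (b : R) (c : 'rV[R]_N) :
  Rbox_tilde sigma 1 (b `^ pmin sigma) c = obox c (awidth sigma b).
Proof.
have E i : (b `^ pmin sigma * 1) `^ (1 / (N%:R + sigma i)) = awidth sigma b ord0 i.
  by rewrite mulr1 -powRrM mulrA mulr1 mxE.
by apply/seteqP; split => y yc i; have := yc i; rewrite E.
Qed.

End cubes_as_boxes.

(** * Choice of the constants and verification of the six properties *)

Theorem theorem3p8 (R : realType) (n : nat) :
  exists rho0 : R, 0 < rho0 /\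
  forall lambda Lambda : R, 0 < lambda -> lambda <= Lambda ->
  exists varsigma C : R, 0 < varsigma /\ 0 < C /\
  forall sigma : 'I_n.+1 -> R, (forall i, 0 < sigma i < 2) ->
  forall f u : 'rV[R]_n.+1 -> R,
    continuous f -> bounded_fun f ->
    measurable_fun [set: lebesgue_rV_type R n.+1] u ->
    (forall x, ~ eball 0 1 x -> u x <= 0) ->
    viscosity_subsolution (Mplus sigma lambda Lambda) (eball 0 1)
      (fun x => - f x) u ->
  let Gamma := concave_envelope u in
  exists (m : nat) (x : 'I_m -> 'rV[R]_n.+1) (r s : 'I_m -> R),
    (forall j, 0 < r j /\ 0 < s j) /\
    let B j := Rbox sigma (r j) (s j) (x j) in
    let Bt j := Rbox_tilde sigma (r j) (s j) (x j) in
    (forall i j, i != j -> B i `&` B j = set0) /\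
    contact_set u Gamma `<=` \bigcup_j closure (B j) /\
    (forall j, contact_set u Gamma `&` closure (B j) !=set0) /\
    (forall j, diam (B j) <= Num.sqrt
       (\sum_i (rho0 * 2 `^ (- (1 / q_max sigma)))
                 `^ (2 / (n.+1%:R + sigma i)))) /\
    (forall j,
       lebesgue_rV (grad_image Gamma (closure (B j))) <=
       (C * sup [set Num.max (f y) 0 | y in closure (B j)] ^+ n.+1)%:E
       * lebesgue_rV (closure (B j)))%E /\
    (forall j,
       varsigma%:E * lebesgue_rV (Bt j) <=
       lebesgue_rV [set y | dilate C (x j) (Bt j) y /\
         (Gamma y - C * sup [set f z | z in closure (B j)]
                     * diam (Bt j) ^+ 2 <= u y)%R])%E.
Proof.
exists (rho0 n); split; first exact: rho0_gt0.
move=> lambda Lambda lambda0 lambdaLambda.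
pose gamma : R := rho0 n ^+ 2 / (12 * (n.+1%:R + 2)).
have gamma0 : 0 < gamma.
  by rewrite divr_gt0 ?exprn_gt0 ?rho0_gt0// mulr_gt0// ltr_wpDl.
(* Solves [lambda * A * gamma = 16 * N], the threshold that the pigeonhole argument requires;
   [gamma] is the lower bound for the sum over scales and depends on the dimension only. *)
pose A := 16 * n.+1%:R / (lambda * gamma).
have A0 : 0 < A by apply: divr_gt0; apply: mulr_gt0.
have A32 : 0 < (32 * A) ^+ n.+1 by rewrite exprn_gt0// mulr_gt0.
have [C [C9 CA CN]] : exists C, [/\ 9 <= C, 64 * A <= C & (32 * A) ^+ n.+1 <= C].
  exists (9 + 64 * A + (32 * A) ^+ n.+1).
  by move: ((32 * A) ^+ n.+1) (64 * A) A32 (mulr_gt0 (ltr0n _ 64) A0) => t v t0 v0; split; lra.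
exists 2^-1, C; split; first by [].
split; first by lra.
move=> sigma sigma_bnd f u _ [M0 [_ f_bnd]] u_meas u_neg u_sub Gamma.
have {}f_bnd y : `|f y| <= M0 + 1 by apply: (f_bnd (M0 + 1)) => //; rewrite ltrDl.
have u_usc := u_sub.1.
pose b0 := half0 sigma.
have b00 : 0 < b0 := half0_gt0 sigma.
have [J sumJ] := sum_scales_ge sigma_bnd.
have sumJ' : 16 * n.+1%:R <=
    c_ sigma * lambda * A * \sum_(j < J) (8 * half0 sigma / 2 ^+ j) `^ qexp sigma.
  have -> : 16 * n.+1%:R = lambda * A * gamma.
    by rewrite /A; field; rewrite !gt_eqF.
  rewrite -(mulrA (c_ sigma)) [leRHS]mulrAC [leRHS]mulrC.
  by apply: (ler_wpM2l _ sumJ); rewrite ltW// mulr_gt0.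
(* The scale attached to a cube is eight times its half-side, matching the sequence of scales that
   starts at [8 * half0 sigma]. *)
pose good j (c : 'rV[R]_n.+1) := exists x0, [/\ contact_set u Gamma x0,
  closure (obox c (const_mx (b0 / 2 ^+ j))) x0 &
  (lebesgue_rV (bad_set sigma u x0 (8 * (b0 / 2 ^+ j)) (A * f x0 * (8 * (b0 / 2 ^+ j)) ^+ 2))
   <= (bad_frac n * box_volume sigma (8 * (b0 / 2 ^+ j)))%:E)%E].
have good_contact x : contact_set u Gamma x -> exists2 j, (j < J)%N &
    forall c, closure (obox c (const_mx (b0 / 2 ^+ j))) x -> good j c.
  move=> xu.
  have [j jP] := good_scale lambda0 lambdaLambda sigma_bnd u_meas u_neg u_sub xu
    (mulr_gt0 (ltr0n _ 8) b00) A0 sumJ'.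
  exists j => // c xc; exists x; split => //.
  by rewrite mulrA.
have contact_bnd x : contact_set u Gamma x -> forall i, `|x ord0 i| <= 1.
  move=> [/eball0P x1 _] i; exact: le_trans (ler_coord_enorm _ _) (ltW x1).
have [m [c [l [lgood disj cover]]]] := dyadic_selection b00 contact_bnd good_contact.
pose b k := b0 / 2 ^+ l k.
have bk0 k : 0 < b k by rewrite divr_gt0 ?exprn_gt0.
have bk1 k : b k <= b0.
  by rewrite ler_pdivrMr ?exprn_gt0// ler_peMr ?(ltW b00)// exprn_ege1// ler1n.
have b8 k : 8 * b k <= 1.
  by apply: le_trans (scale0_le1 sigma_bnd); rewrite ler_pM2l.
have width k i : awidth sigma (8 * b k) ord0 i <= n.+1%:R^-1.
  apply: le_trans (awidth_scale0 sigma_bnd i); apply: awidth_mono => //.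
  by rewrite ler_pM2l// bk1 andbT mulr_ge0// ltW.
exists m, c, (fun=> 1), (fun k => b k `^ pmin sigma).
split=> [k|]; first by split=> //; exact: powR_gt0.
have BE k : Rbox sigma 1 (b k `^ pmin sigma) (c k) = obox (c k) (const_mx (b k)).
  exact: Rbox_cube.
have BtE k : Rbox_tilde sigma 1 (b k `^ pmin sigma) (c k) = obox (c k) (awidth sigma (b k)).
  exact: Rbox_tilde_cube.
split; [|split; [|split; [|split; [|split]]]].
- by move=> i j ij; rewrite !BE; exact: disj.
- by move=> x /cover[k _ xk]; exists k => //; rewrite BE.
- by move=> k; rewrite BE; have [_ [x0 [x0u x0c _]]] := lgood k; exists x0.
- move=> k; rewrite BE; apply: (le_trans (diam_obox_le _ _)) => [i|].
    by rewrite mxE.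
  apply: ler_wsqrtr; apply: ler_sum => i _; rewrite mxE.
  have := double_half0_le sigma_bnd i.
  set X := rho0 n * _; rewrite -/X => hX.
  rewrite (_ : 2 / (n.+1%:R + sigma i) = 1 / (n.+1%:R + sigma i) * 2%:R); last first.
    by rewrite mulrAC mul1r.
  rewrite powRrM powR_mulrn ?powR_ge0//.
  have b2 : 0 <= 2 * b k by apply: mulr_ge0 => //; exact: ltW.
  rewrite ler_sqr ?nnegrE ?powR_ge0//.
  by apply: le_trans hX; rewrite ler_pM2l.
- move=> k; rewrite BE; have [_ [x0 [x0u x0c bad]]] := lgood k.
  have fx0 := rhs_contact_ge0 lambda0 lambdaLambda sigma_bnd u_neg u_sub x0u.
  apply: (le_trans (good_cube_gradient sigma_bnd u_neg u_usc f_bnd x0u fx0 A0 (bk0 k)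
    (b8 k) (width k) x0c bad)).
  apply: lee_wpmul2r; first exact: mu_ext_ge0.
  rewrite lee_fin ler_wpM2r// exprn_ge0//.
  by apply: le_trans (le_sup_positive_part f_bnd x0c); rewrite le_max lexx orbT.
- move=> k; rewrite BE BtE; have [_ [x0 [x0u x0c bad]]] := lgood k.
  have fx0 := rhs_contact_ge0 lambda0 lambdaLambda sigma_bnd u_neg u_sub x0u.
  exact: (good_cube_measure sigma_bnd u_neg u_usc f_bnd x0u fx0 A0 (bk0 k)
    (b8 k) (width k) x0c bad C9 CA).
Qed.
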